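(* Let $E$ and $V$ be complex vector spaces of the same dimension $N$ and let $\pi:E\to V$ be a dominant morphism, with ramification divisor $R_\pi$ and reduced Jacobian $J_{red}$. For $(a,b)\in \mathrm{Aff}_1=(E\setminus\{0\})\times E$, let $\varphi:\mathbb C\to E$, $z\mapsto az+b$, and let $\delta\in\mathbb C[z]$ and $Q_N\in\mathbb C[z]^N$ be the polynomial and the polynomial vector constructed from $(a,b)$ in the context. Assume that $(a,b)\in\mathrm{Aff}_1$ is general (i.e. it belongs to a suitable nonempty Zariski open subset of $\mathrm{Aff}_1$ depending only on $\pi$). Then the divisor $R_\pi$ is contracted by $\pi$ if and only if $\delta$ divides $T_{\varphi(z)}J_{red}(Q_N(z))$ in $\mathbb C[z]$.
   Context: Fix bases of $E$ and $V$ and let $M(x)$ be the matrix of the tangent map $T_x\pi$ in these bases; $M$ is an $N\times N$ matrix with entries in $\mathbb C[E]$. Let $J=\det M\in\mathbb C[E]$ be the Jacobian determinant, nonzero since $\pi$ is dominant, with factorization $J=\prod_{i=1}^t f_i^{m_i}$ into powers of pairwise non-associate irreducible polynomials (up to a scalar), and let $J_{red}=\prod_{i=1}^t f_i$. The ramification divisor $R_\pi$ is the divisor $\mathrm{div}(J)$ of $E$; $J_{red}$ is the reduced equation of its support. $R_\pi$ is contracted by $\pi$ if $\overline{\pi(\mathrm{supp}(R_\pi))}$ has codimension at least two in $V$. For $(a,b)\in\mathrm{Aff}_1$ set $M_z=M\circ\varphi$, a matrix with entries in $\mathbb C[z]$; for general $(a,b)$, $\det M_z\ne0$. By Smith's theorem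 there are $P,Q\in \mathrm{GL}_N(\mathbb C[z])$ with $P M_z Q=\mathrm{diag}(s_1,\dots,s_N)$, $s_i\in\mathbb C[z]$, and $s_i$ dividing $s_{i+1}$ for each $i$. (If $N=1$, put $s_0=1$.) Set $$\delta_1=\frac{s_N}{\gcd(s_{N-1}^N,s_N)},\qquad \delta=\frac{\delta_1}{\gcd(\delta_1,\delta_1')},$$ where $\delta_1'$ is the derivative of $\delta_1$. Let $Q_N\in\mathbb C[z]^N$ be the last column of $Q$. Finally, $T_{\varphi(z)}J_{red}(Q_N(z))=\sum_{i=1}^N\frac{\partial J_{red}}{\partial x_i}(\varphi(z))\,(Q_N(z))_i\in\mathbb C[z]$, where $x_1,\dots,x_N$ are the coordinates on $E$ in the fixed basis. *)

(* Defs.v *)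
(* The field of complex numbers is R[i] for R : realType; a vector space of
   dimension N >= 1 is a vectType over R[i] of dimension n.+1. *)
From HB Require Import structures.
From mathcomp Require Import all_boot all_order all_algebra.
From mathcomp Require Import mpoly complex.
From mathcomp Require Import boolp classical_sets reals.
Set Implicit Arguments.
Unset Strict Implicit.
Unset Printing Implicit Defensive.
Import Order.TTheory GRing.Theory Num.Theory.
Local Open Scope classical_set_scope.
Local Open Scope ring_scope.

Section ZariskiTopology.
Variable K : fieldType.

(* The coordinate ring of W is generated by the linear forms on W. *)
Definition regular (W : vectType K) (g : W -> K) : Prop :=
  exists (k : nat) (l : 'I_k -> {scalar W}) (q : {mpoly K[k]}),
    forall x, g x = q.@[fun i => l i x].

Definition zclosed (W : vectType K) (Z : set W) : Prop :=
  exists F : set (W -> K),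
    (forall g, F g -> regular g) /\ Z = [set x | forall g, F g -> g x = 0].

Definition zopen (W : vectType K) (U : set W) : Prop := zclosed (~` U).

Definition zclosure (W : vectType K) (A : set W) : set W :=
  \bigcap_(Z in [set Z | zclosed Z /\ A `<=` Z]) Z.

Definition irreducible_zclosed (W : vectType K) (Y : set W) : Prop :=
  [/\ zclosed Y, Y !=set0 &
      forall A B, zclosed A -> zclosed B -> Y `<=` A `|` B ->
        Y `<=` A \/ Y `<=` B].

(* codim(Z, W) >= k for a Zariski closed subset Z: the codimension of Z is the
   infimum, over the irreducible closed Y contained in Z, of the supremum of
   the lengths of the chains of irreducible closed subsets of W starting at Y.
   The empty set has infinite codimension. *)
Definition codim_ge (W : vectType K) (k : nat) (Z : set W) : Prop :=
  forall Y, irreducible_zclosed Y -> Y `<=` Z ->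
    exists c : nat -> set W,
      [/\ c 0%N = Y,
          forall i, (i <= k)%N -> irreducible_zclosed (c i) &
          forall i, (i < k)%N -> c i `<` c i.+1].

Definition morphism (E V : vectType K) (phi : E -> V) : Prop :=
  forall g : V -> K, regular g -> regular (g \o phi).

Definition dominant (E V : vectType K) (phi : E -> V) : Prop :=
  zclosure (range phi) = setT.

Definition Aff1 (E : vectType K) : set (E * E)%type := [set ab | ab.1 != 0].

End ZariskiTopology.

Section Factorization.
Variable A : idomainType.

Definition irreducible_elt (x : A) : Prop :=
  [/\ x != 0, x \isn't a GRing.unit &
      forall y z, x = y * z -> y \is a GRing.unit \/ z \is a GRing.unit].

Definition associate (x y : A) : Prop :=
  exists2 u, u \is a GRing.unit & x = u * y.

Definition factorization (t : nat) (f : 'I_t -> A) (m : 'I_t -> nat) (x : A) :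
    Prop :=
  [/\ forall i, irreducible_elt (f i),
      forall i, (0 < m i)%N,
      forall i j, i != j -> ~ associate (f i) (f j) &
      associate x (\prod_(i < t) f i ^+ m i)].

End Factorization.

Section Coordinates.
Variables (K : fieldType) (n : nat).

(* p lists the components of pi : E -> V in the bases e of E and v of V. *)
Definition components (E V : vectType K) (e : n.+1.-tuple E)
    (v : n.+1.-tuple V) (pi : E -> V) (p : 'I_n.+1 -> {mpoly K[n.+1]}) : Prop :=
  forall x i, coord v i (pi x) = (p i).@[fun j => coord e j x].

Definition tangent_mx (p : 'I_n.+1 -> {mpoly K[n.+1]}) :
    'M[{mpoly K[n.+1]}]_n.+1 :=
  \matrix_(i, j) (p i)^`M(j).

Definition zero_locus (E : vectType K) (e : n.+1.-tuple E)
    (g : {mpoly K[n.+1]}) : set E :=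
  [set x | g.@[fun j => coord e j x] = 0].

(* The ramification divisor div(J), with support the zero locus of J, is
   contracted by pi. *)
Definition contracted (E V : vectType K) (e : n.+1.-tuple E) (pi : E -> V)
    (J : {mpoly K[n.+1]}) : Prop :=
  codim_ge 2 (zclosure (pi @` zero_locus e J)).

(* g |-> g \o phi, from K[E] to K[z], where phi(z) = z a + b. *)
Definition line_pullback (E : vectType K) (e : n.+1.-tuple E) (a b : E)
    (g : {mpoly K[n.+1]}) : {poly K} :=
  mmap (@polyC K) (fun j => coord e j a *: 'X + (coord e j b)%:P) g.

Definition smith_form (Mz P Q : 'M[{poly K}]_n.+1) (s : 'rV[{poly K}]_n.+1) :
    Prop :=
  [/\ P \in unitmx, Q \in unitmx, P *m Mz *m Q = diag_mx s &
      forall i j : 'I_n.+1, j = i.+1 :> nat -> s 0 i %| s 0 j].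

(* s_N and s_(N-1), with s_0 = 1; the indices of s run from 0 to n = N - 1. *)
Definition smith_last (s : 'rV[{poly K}]_n.+1) : {poly K} := s 0 ord_max.

Definition smith_prev (s : 'rV[{poly K}]_n.+1) : {poly K} :=
  if n == 0%N then 1 else s 0 (inord n.-1).

Definition delta1 (s : 'rV[{poly K}]_n.+1) : {poly K} :=
  smith_last s %/ gcdp (smith_prev s ^+ n.+1) (smith_last s).

Definition delta (s : 'rV[{poly K}]_n.+1) : {poly K} :=
  delta1 s %/ gcdp (delta1 s) (delta1 s)^`().

(* T_(phi(z)) g (w(z)) for a polynomial vector w. *)
Definition tangent_along (E : vectType K) (e : n.+1.-tuple E) (a b : E)
    (g : {mpoly K[n.+1]}) (w : 'cV[{poly K}]_n.+1) : {poly K} :=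
  \sum_(i < n.+1) line_pullback e a b g^`M(i) * w i 0.

End Coordinates.

(* Main.v *)
(* Let p be the components of pi, M its tangent matrix, J = det M, and let f be
   an irreducible factor of J.

   Contraction.  By the Jacobian criterion the closure of pi({f = 0}) contains
   a hypersurface if and only if the matrix M augmented by the row df has full
   rank at the generic point of f = 0: relations among the p_i modulo f are
   differentiated along vector fields tangent to f = 0.  So R_pi is contracted
   if and only if this rank condition fails for every f.

   Kernel field.  Write adj M = f^c B with f not dividing B, so that M B is a
   scalar matrix.  If the rank condition fails for f, some combination B W is
   nonzero and tangent to f = 0 at its generic point.  This is clear if all the
   columns of B are tangent; if a column X is transverse, then X kills p modulo
   f^e, and a tangent field Y killing p modulo f^i is improved, up to a factor,
   to Y - f/(i X(f)) [X, Y], which kills p modulo f^(i+1); at i = e the field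
   lies in the image of B.

   Lines.  Let z be a root of delta and x = phi(z), a general point of f = 0.
   Then s_N vanishes at z to a higher order than s_(N-1), so B(x) has its image
   spanned by Q_N(z), which is therefore proportional to B W at x and tangent.
   Conversely, if the rank condition holds for f, then delta vanishes at a point
   z of the line on f = 0, and Q_N(z) spans the kernel of M at x, on which df
   does not vanish. *)
Require Import Defs.
From HB Require Import structures.
From mathcomp Require Import all_boot all_order all_algebra.
From mathcomp Require Import ring_quotient separable ring zify.
From mathcomp Require Import mpoly complex.
From mathcomp Require Import boolp classical_sets reals.
Set Implicit Arguments.
Unset Strict Implicit.
Unset Printing Implicit Defensive.
Import Order.TTheory GRing.Theory Num.Theory.
Local Open Scope classical_set_scope.
Local Open Scope ring_scope.

(** * Prime elements and unique factorization *)

(** Ideals, function fields and dimension theory are replaced by divisibility by a prime element: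
    the ideal of the closure of pi({f = 0}) is the set of q such that f divides q(p), and this
    closure contains {h = 0} exactly when that set lies in (h). The obstacle is that M may drop rank
    by more than one along f = 0. A field killing p modulo f is then one of many kernel directions,
    while Q_N at a root of delta can only be compared with the image of B. Lifting the field to the
    full order e forces it into that image: M Y = f^e W and B M = f^e J' give B W = J' Y, with J'
    not divisible by f. Genericity is read off the universal line f(b + a z), which is prime in
    K[a, b, z] when f is prime; a Bezout relation with value in K[a, b] then acts as a resultant.
    The same device yields the Nullstellensatz for prime hypersurfaces. Finally, the open set has to
    be found before the bases, the factorization and the Smith form are given, so it is built from
    one choice of bases and factorization, and the criterion is carried to all others. *)

Section PrimeElements.
Variable A : idomainType.
Implicit Types p x y : A.

(** Divisibility in [A] itself; over a domain, [%|] on [{poly A}] only expresses divisibility up to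
    a nonzero constant. *)
Definition rdvd p x : Prop := exists c, x = c * p.

Definition prime_elt p : Prop :=
  [/\ p != 0, p \isn't a GRing.unit &
      forall x y, rdvd p (x * y) -> rdvd p x \/ rdvd p y].

Lemma rdvd_refl p : rdvd p p.
Proof. by exists 1; rewrite mul1r. Qed.

Lemma rdvd0 p : rdvd p 0.
Proof. by exists 0; rewrite mul0r. Qed.

Lemma rdvdMl p x y : rdvd p x -> rdvd p (y * x).
Proof. by case=> c ->; exists (y * c); rewrite mulrA. Qed.

Lemma rdvdMr p x y : rdvd p x -> rdvd p (x * y).
Proof. by rewrite mulrC; exact: rdvdMl. Qed.

Lemma rdvdD p x y : rdvd p x -> rdvd p y -> rdvd p (x + y).
Proof. by case=> c -> [d ->]; exists (c + d); rewrite mulrDl. Qed.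

Lemma rdvdN p x : rdvd p x -> rdvd p (- x).
Proof. by case=> c ->; exists (- c); rewrite mulNr. Qed.

Lemma rdvdB p x y : rdvd p x -> rdvd p y -> rdvd p (x - y).
Proof. by move=> ? ?; apply/rdvdD/rdvdN. Qed.

Lemma rdvd_sum (I : Type) (r : seq I) (P : pred I) p (F : I -> A) :
  (forall i, P i -> rdvd p (F i)) -> rdvd p (\sum_(i <- r | P i) F i).
Proof. by move=> h; elim/big_ind: _ => //; [exact: rdvd0|exact: rdvdD]. Qed.

Lemma rdvdMU u p x : u \is a GRing.unit -> rdvd p (u * x) -> rdvd p x.
Proof. by move=> uU /(rdvdMl u^-1); rewrite mulKr. Qed.

Lemma prime_eltU p x : prime_elt p -> rdvd p x -> x \isn't a GRing.unit.
Proof.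
case=> p0 pU _ [c ->]; apply: contra pU; rewrite unitrM.
by case/andP.
Qed.

Lemma prime_elt_prod p (I : Type) (r : seq I) (P : pred I) (F : I -> A) :
  prime_elt p -> rdvd p (\prod_(i <- r | P i) F i) ->
  exists2 i, P i & rdvd p (F i).
Proof.
move=> pp; elim: r => [|i r IH].
  by rewrite big_nil => /(prime_eltU pp); rewrite unitr1.
rewrite big_cons; case: ifP => // Pi; case: pp => _ _ /[apply].
by case=> // h; exists i.
Qed.

Lemma prime_eltX p x k : prime_elt p -> rdvd p (x ^+ k) -> rdvd p x.
Proof.
move=> pp; rewrite -(card_ord k) -prodr_const.
by case/(prime_elt_prod pp).
Qed.

Lemma prime_elt_irr p : prime_elt p -> irreducible_elt p.
Proof.
case=> p0 pU pP; split=> // y z e.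
have : rdvd p (y * z) by rewrite -e; exact: rdvd_refl.
have U (c w : A) : p = p * (c * w) -> w \is a GRing.unit.
  rewrite -{1}[p]mulr1 => /(mulfI p0) cw1.
  by apply/unitrPr; exists c; rewrite mulrC -cw1.
case/pP=> -[c ec]; [right|left]; apply: (U c); rewrite {1}e ec; ring.
Qed.

(* The quotient by (p) is only a comNzRing in the library: its units are
   supplied classically. *)
Lemma prime_quotient p : prime_elt p ->
  exists (Q : idomainType) (rho : {rmorphism A -> Q}),
    (forall x, rdvd p x <-> rho x = 0) /\ forall y : Q, exists x, rho x = y.
Proof.
case=> p0 pU pP.
pose S := fun x => `[<rdvd p x>].
have S_ideal : idealr_closed S.
  split; first by apply/asboolP; exact: rdvd0.
    apply/asboolP => -[c c1]; move/negP: pU; apply.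
    by apply/unitrPr; exists c; rewrite mulrC.
  by move=> a u v /asboolP hu /asboolP hv; apply/asboolP/rdvdD/hv/rdvdMl.
have S_prime : prime_idealr_closed S.
  by move=> u v /asboolP /pP [] h; apply/orP; [left|right]; apply/asboolP.
pose Iz := isIdealr.Build A S S_ideal.
pose I : prime_idealr A := HB.pack S Iz (isPrimeIdealrClosed.Build A S S_prime).
pose Q0 : comNzRingType := {ideal_quot I}.
pose un : pred Q0 := fun x : Q0 => `[<exists y : Q0, y * x = 1>].
pose iv (x : Q0) : Q0 :=
  if pselect (exists y : Q0, y * x = 1) is left h
  then xget 0 [set y : Q0 | y * x = 1] else x.
have mulV : {in un, left_inverse 1 iv *%R}.
  move=> x /asboolP h; rewrite /iv; case: pselect => // h'.
  by have := xgetPex 0 h'.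
have ivP (x y : Q0) : y * x = 1 -> un x by move=> h; apply/asboolP; exists y.
have ivo : {in [predC un], iv =1 id}.
  by move=> x /asboolP h; rewrite /iv; case: pselect.
pose Qu := GRing.ComNzRing_hasMulInverse.Build Q0 mulV ivP ivo.
pose QU : comUnitRingType := HB.pack Q0 Qu.
have QI : GRing.integral_domain_axiom QU by exact: (@Quotient.rquot_IdomainAxiom A I).
pose Q : idomainType := HB.pack Q0 Qu (GRing.ComUnitRing_isIntegral.Build QU QI).
exists Q, ((\pi_Q0)%qT : {rmorphism A -> Q0}); split=> [x|y]; last first.
  by exists (repr (y : Q0)); rewrite /= reprK.
rewrite /=; have := @Quotient.idealrBE A I x 0; rewrite subr0 => e.
split.
  move=> /asboolP h; have : x \in (I : zmodClosed A) by [].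
  by rewrite e => /eqP ->; rewrite rmorph0.
move=> h; apply/asboolP; suff : x \in (I : zmodClosed A) by [].
by rewrite e h; apply/eqP; rewrite -(rmorph0 ((\pi_Q0)%qT : {rmorphism A -> Q0})).
Qed.

End PrimeElements.

Lemma prime_elt_quotient (A Q : idomainType) (rho : {rmorphism A -> Q}) (p : A) :
  p != 0 -> (forall x, rdvd p x <-> rho x = 0) -> prime_elt p.
Proof.
move=> p0 ker; split=> //.
  apply/negP => /unitrPr[c pc].
  have /ker : rdvd p 1 by exists c; rewrite mulrC.
  by rewrite rmorph1 => /eqP; rewrite oner_eq0.
move=> x y /ker; rewrite rmorphM => /eqP; rewrite mulf_eq0.
by case/orP => /eqP /ker; [left|right].
Qed.

(** Gauss's lemma: reducing coefficients modulo [p] lands in the polynomials over a domain, and the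
    kernel is generated by the constant [p]. *)
Lemma prime_elt_polyC (A : idomainType) (p : A) :
  prime_elt p -> prime_elt p%:P.
Proof.
move=> pp; have [p0 _ _] := pp; have [Q [rho [ker _]]] := prime_quotient pp.
apply: (@prime_elt_quotient _ _ (map_poly rho)); first by rewrite polyC_eq0.
move=> x; split.
  by case=> c ->; rewrite rmorphM /= map_polyC /= (ker p).1 ?mulr0 //; exact: rdvd_refl.
move=> x0; have h i : {c | x`_i = c * p}.
  apply/cid/ker; move/polyP/(_ i): x0.
  by rewrite coef_map coef0.
exists (\poly_(i < size x) sval (h i)); apply/polyP => i.
rewrite coefMC coef_poly; case: ltnP => [_|/leq_sizeP->//]; last by rewrite mul0r.
by case: (h i).
Qed.

Lemma prime_elt_mpolyC (A : idomainType) n (p : A) :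
  prime_elt p -> prime_elt (p%:MP_[n]).
Proof.
move=> pp; have [p0 _ _] := pp; have [Q [rho [ker _]]] := prime_quotient pp.
apply: (@prime_elt_quotient _ _ (map_mpoly rho)); first by rewrite mpolyC_eq0.
move=> x; split.
  by case=> c ->; rewrite rmorphM /= map_mpolyC /= (ker p).1 ?mulr0 //; exact: rdvd_refl.
move=> x0; have h m : {c | x@_m = c * p}.
  apply/cid/ker; move/mpolyP/(_ m): x0.
  by rewrite mcoeff_map_mpoly mcoeff0.
exists (\sum_(m <- msupp x) sval (h m) *: 'X_[m]).
rewrite {1}[x]mpolyE mulr_suml; apply: eq_bigr => m _.
by rewrite mulrC mul_mpolyC scalerA mulrC; case: (h m) => c /= <-.
Qed.

Lemma rdvd_rmorph (A B : idomainType) (phi : {rmorphism A -> B}) (p x : A) :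
  rdvd p x -> rdvd (phi p) (phi x).
Proof. by case=> c ->; exists (phi c); rewrite rmorphM. Qed.

Lemma rdvd_can (A B : idomainType) (phi : {rmorphism A -> B})
    (psi : {rmorphism B -> A}) (p x : A) :
  cancel phi psi -> rdvd (phi p) (phi x) -> rdvd p x.
Proof. by move=> phiK /(rdvd_rmorph psi); rewrite !phiK. Qed.

Lemma prime_elt_iso (A B : idomainType) (phi : {rmorphism A -> B})
    (psi : {rmorphism B -> A}) (p : A) :
  cancel phi psi -> cancel psi phi -> prime_elt p -> prime_elt (phi p).
Proof.
move=> phiK psiK [p0 pU pP]; split.
- by rewrite -(inj_eq (can_inj psiK)) phiK rmorph0.
- by apply: contra pU => /(rmorph_unit psi); rewrite phiK.
- move=> x y /(rdvd_rmorph psi); rewrite phiK rmorphM => /pP.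
  by case=> /(rdvd_rmorph phi); rewrite psiK; [left|right].
Qed.

(** * Gauss's theorem on unique factorization *)

Section Factorial.

Definition prime_product (A : idomainType) (x : A) : Prop :=
  exists (s : seq A) (u : A),
    [/\ u \is a GRing.unit, (forall p, p \in s -> prime_elt p) &
        x = u * \prod_(p <- s) p].

(* The form of unique factorization that passes to polynomial rings. *)
Definition ufd (A : idomainType) := forall x : A, x != 0 -> prime_product x.

Variable A : idomainType.

Lemma ufd_irreducible (x : A) :
  ufd A -> irreducible_elt x -> prime_elt x.
Proof.
move=> fA [x0 xU xirr]; have [s [u [uU sP ex]]] := fA x x0.
case: s => [|p s] in sP ex.
  by move: xU; rewrite ex big_nil mulr1 uU.
have pp : prime_elt p by apply: sP; rewrite mem_head.
have [p0 pU pP] := pp; move: ex; rewrite big_cons mulrCA.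
set w := _ * \prod_(_ <- _) _ => ex.
case: (xirr _ _ ex) => [h|wU]; first by rewrite h in pU.
split=> // y z [c ec].
have /pP : rdvd p (y * z) by exists (c * w); rewrite ec ex; ring.
have d t : rdvd p t -> rdvd x t.
  by case=> e ->; exists (e * w^-1); rewrite ex -mulrA [w^-1 * _]mulrC mulrK.
by case=> /d; [left|right].
Qed.

Lemma prime_elt_assoc (p q : A) : prime_elt p -> prime_elt q -> rdvd p q ->
  exists2 u, u \is a GRing.unit & q = u * p.
Proof.
move=> pp qp [c ec]; exists c => //.
case: (prime_elt_irr qp) => _ _ /(_ c p ec) [//|pU].
by case: pp => _; rewrite pU.
Qed.

(** The prime [p] is associate to a member of [s], which is removed; the shorter list feeds the
    inner induction of [poly_ufd]. *)
Lemma prime_cofactor (s : seq A) (p z : A) : prime_elt p ->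
  (forall q, q \in s -> prime_elt q) -> \prod_(q <- s) q = p * z ->
  exists (s' : seq A) (u : A), [/\ u \is a GRing.unit,
    (forall q, q \in s' -> prime_elt q), (size s' < size s)%N &
    z = u * \prod_(q <- s') q].
Proof.
move=> pp; have [p0 pU pP] := pp.
elim: s z => [|q s IH] z sP.
  rewrite big_nil => e; have := prime_eltU pp (x := p * z) (rdvdMr z (rdvd_refl p)).
  by rewrite -e unitr1.
have qp : prime_elt q by apply: sP; rewrite mem_head.
have sP' t : t \in s -> prime_elt t by move=> h; apply: sP; rewrite inE h orbT.
rewrite big_cons => e.
have /pP[pq|ps] : rdvd p (q * \prod_(q <- s) q) by exists z; rewrite e mulrC.
  have [u uU eq] := prime_elt_assoc pp qp pq.
  exists s, u; split=> //; apply: (mulfI p0); rewrite -e eq; ring.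
case: ps => c ec; have [|s' [u [uU s'P lt ec']]] := IH c sP'.
  by rewrite ec mulrC.
exists (q :: s'), u; split=> //.
  by move=> t; rewrite inE => /predU1P[->//|/s'P].
by apply: (mulfI p0); rewrite -e ec ec' big_cons; ring.
Qed.

(** Each prime of the constant divides [f * h], hence [h], and cancels: [f] behaves like a primitive
    polynomial. *)
Lemma rdvd_polyC_cancel (s : seq A) (f g h : {poly A}) :
  (forall q, q \in s -> prime_elt q /\ ~ rdvd q%:P f) ->
  (\prod_(q <- s) q)%:P * g = f * h -> rdvd f g.
Proof.
elim: s h => [|q s IH] h sP.
  by rewrite big_nil mul1r => ->; exists h; rewrite mulrC.
rewrite big_cons polyCM -mulrA => e.
have [qp qf] := sP q (mem_head _ _); have qP := prime_elt_polyC qp.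
have [q0 _ qpr] := qP.
have /qpr[//|[c ec]] : rdvd q%:P (f * h).
  by rewrite -e; exact/rdvdMr/rdvd_refl.
apply: (IH c) => [t ht|]; first by apply: sP; rewrite inE ht orbT.
by apply: (mulfI q0); rewrite e ec; ring.
Qed.

(** Clears denominators: each prime of the constant divides [d] or [k] and is removed there, which
    leaves the degrees unchanged. *)
Lemma polyC_split (s : seq A) (f d k : {poly A}) :
  (forall q, q \in s -> prime_elt q) -> (\prod_(q <- s) q)%:P * f = d * k ->
  exists d' k', [/\ f = d' * k', size d' = size d & size k' = size k].
Proof.
elim: s d k => [|q s IH] d k sP.
  by rewrite big_nil mul1r => ->; exists d, k.
rewrite big_cons polyCM -mulrA => e.
have qp := sP q (mem_head _ _); have qP := prime_elt_polyC qp.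
have sP' t : t \in s -> prime_elt t by move=> h; apply: sP; rewrite inE h orbT.
have [q0 _ qpr] := qP; have qA0 : q != 0 by case: qp.
have sz c : size (c * q%:P) = size c.
  by rewrite mulrC -[q%:P * c]/(_ * c) mul_polyC size_scale.
have /qpr[[c ec]|[c ec]] : rdvd q%:P (d * k).
  by rewrite -e; exact/rdvdMr/rdvd_refl.
  have [|d' [k' [e1 e2 e3]]] := IH c k sP'.
    by apply: (mulfI q0); rewrite e ec; ring.
  by exists d', k'; rewrite ec sz.
have [|d' [k' [e1 e2 e3]]] := IH d c sP'.
  by apply: (mulfI q0); rewrite e ec; ring.
by exists d', k'; rewrite ec sz.
Qed.

End Factorial.

(** The gcd over the fraction field is constant; [r] comes from clearing denominators and plays the
    role of a resultant. *)
Lemma Bezout_const (A : idomainType) (f g : {poly A}) :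
  f != 0 -> (size (gcdp f g) <= 1)%N ->
  exists u v r, r != 0 /\ u * f + v * g = r%:P.
Proof.
move=> f0 sz; have d0 : gcdp f g != 0 by rewrite gcdp_eq0 negb_and f0.
have [[u v]] := Bezoutp f g.
case/Pdiv.Idomain.eqpP => -[c1 c2] /= /andP[c10 c20].
rewrite (size1_polyC sz) => e.
exists (c1 *: u), (c1 *: v), (c2 * (gcdp f g)`_0); split; last first.
  by rewrite -!scalerAl -scalerDr e -mul_polyC polyCM.
rewrite mulf_neq0 //; apply: contraNneq d0 => h.
by rewrite (size1_polyC sz) h.
Qed.

(** With d the gcd, a constant multiple of [f] is k d. If [f] divides k, then d is constant; if [f]
    divides d, it divides a constant times [g], hence [g]. *)
Lemma prime_Bezout (A : idomainType) (f g : {poly A}) :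
  prime_elt f -> (1 < size f)%N -> ~ rdvd f g ->
  exists u v r, r != 0 /\ u * f + v * g = r%:P.
Proof.
move=> fp sf fg; have [f0 _ fP] := fp.
apply: Bezout_const => //; set d := gcdp f g.
have /Pdiv.Idomain.dvdpP[[c k] /= c0 e] : d %| f by rewrite dvdp_gcdl.
have /Pdiv.Idomain.dvdpP[[c' k'] /= c'0 e'] : d %| g by rewrite dvdp_gcdr.
have d0 : d != 0 by rewrite gcdp_eq0 negb_and f0.
have /fP[|] : rdvd f (k * d).
  by rewrite -e -mul_polyC; exact/rdvdMl/rdvd_refl.
  case=> w ew; have : c%:P = w * d.
    by apply: (mulfI f0); rewrite mulrC mul_polyC e ew; ring.
  have [->|w0] := eqVneq w 0.
    by rewrite mul0r => /eqP; rewrite polyC_eq0 (negbTE c0).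
  move/(congr1 (size : {poly A} -> nat)).
  rewrite size_polyC c0 size_mul //.
  have aux (a b : nat) : (0 < a)%N -> (0 < b)%N -> 1%N = (a + b).-1 -> (b <= 1)%N by lia.
  by move: w0 d0; rewrite -!size_poly_gt0; exact: aux.
case=> w ew.
have : rdvd f (c'%:P * g).
  by rewrite mul_polyC e' ew; apply: rdvdMl; exact/rdvdMl/rdvd_refl.
case/fP => // -[w' ew'].
have w'0 : w' != 0.
  by apply: contraNneq c'0 => h; rewrite -polyC_eq0 ew' h mul0r.
move/(congr1 (size : {poly A} -> nat)): ew'.
rewrite size_polyC c'0 size_mul //.
have aux (a b : nat) : (0 < a)%N -> (1 < b)%N -> 1%N = (a + b).-1 -> False by lia.
by move: w'0; rewrite -size_poly_gt0 => /aux/(_ sf)/[apply].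
Qed.

(* Elimination of the distinguished variable between the relations h and q. *)
Lemma prime_eliminate (A A' R : idomainType) (phi : {rmorphism A -> {poly R}})
    (psi : {rmorphism {poly R} -> A}) (sigma : {rmorphism A -> A'}) (f : A') (h q : A) :
  cancel phi psi -> cancel psi phi -> prime_elt h -> (1 < size (phi h))%N ->
  ~ rdvd h q -> rdvd f (sigma h) -> rdvd f (sigma q) ->
  exists2 r, r != 0 & rdvd f (sigma (psi r%:P)).
Proof.
move=> phiK psiK hp sh hq fh fq.
have nd : ~ rdvd (phi h) (phi q) := fun d => hq (rdvd_can phiK d).
have [u [v [r [r0 e]]]] := prime_Bezout (prime_elt_iso phiK psiK hp) sh nd.
exists r => //; rewrite -e !rmorphD !rmorphM !phiK.
by apply: rdvdD; apply: rdvdMl.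
Qed.

Lemma size_rdvd_le1 (R : idomainType) (x y : {poly R}) :
  x != 0 -> rdvd y x -> (size x <= 1)%N -> (size y <= 1)%N.
Proof.
move=> + [c ex]; rewrite ex mulf_eq0 negb_or => /andP[c0 y0].
rewrite size_mul //; move: c0; rewrite -size_poly_gt0.
by move: (size c) (size y); clear; lia.
Qed.

(** Induction on the degree and, within a degree, on the number of primes in the leading
    coefficient: extracting a constant prime lowers the second, splitting a polynomial without
    constant primes lowers the first. *)
Lemma poly_ufd (A : idomainType) : ufd A -> ufd {poly A}.
Proof.
move=> fA.
have irr_prime (f : {poly A}) : (1 < size f)%N ->
    (forall q : A, prime_elt q -> ~ rdvd q%:P f) -> irreducible_elt f -> prime_elt f.
  move=> sf fprim [f0 fU firr]; split=> // g h fgh.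
  have [fg|fg] := pselect (rdvd f g); [by left|right].
  have can (c : A) t w : c != 0 -> c%:P * t = f * w -> rdvd f t.
    move=> c0; have [s [u [uU sP ->]]] := fA c c0.
    rewrite polyCM -mulrA => e.
    apply: (@rdvd_polyC_cancel A s f t (u^-1%:P * w)).
      by move=> q /sP qp; split=> //; exact: fprim.
    apply: (mulfI (x := u%:P)).
      by rewrite polyC_eq0; apply: contraTneq uU => ->; rewrite unitr0.
    by rewrite e -[w in LHS]mul1r -[1]/(1%:P) -(divrr uU) polyCM; ring.
  (* If d is constant, a Bezout constant times h is a multiple of f. Otherwise irreducibility makes
     f proportional to d, which divides g up to a constant. In both cases [can] removes the
     constant. *)
  set d := gcdp f g.
  have /Pdiv.Idomain.dvdpP[[c k] /= c0 e] : d %| f by rewrite dvdp_gcdl.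
  have /Pdiv.Idomain.dvdpP[[c' k'] /= c'0 e'] : d %| g by rewrite dvdp_gcdr.
  have [s [u [uU sP ec]]] := fA c c0.
  have u0 : u != 0 by apply: contraTneq uU => ->; rewrite unitr0.
  have [d' [k1 [ef sd' sk1]]] : exists d' k',
      [/\ f = d' * k', size d' = size d & size k' = size k].
    have [|d' [k1 [h1 h2 h3]]] := @polyC_split A s f (u^-1 *: d) k sP.
      rewrite -scalerAl [d * k]mulrC -e ec -mul_polyC -mul_polyC mulrA -polyCM.
      by rewrite mulrA mulVr // mul1r.
    by exists d', k1; rewrite h2 size_scale // invr_eq0.
  have [d1|d1] := leqP (size d) 1.
    have [a [b [r [r0 eB]]]] := Bezout_const f0 d1.
    case: fgh => w ew; apply: (can r h (a * h + b * w)) => //.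
    have -> : r%:P * h = a * f * h + b * (g * h) by rewrite -eB; ring.
    by rewrite ew; ring.
  have k10 : (size k1 <= 1)%N.
    case: (firr _ _ ef) => [|]; rewrite poly_unitE; case/andP => /eqP; last by move=> ->.
    by rewrite sd' => hd; move: d1; rewrite hd.
  exfalso; apply: fg.
  have k0 : k`_0 != 0.
    apply: contraNneq f0 => kz; move: k10; rewrite sk1 => /size1_polyC hk.
    move: sk1; rewrite hk kz size_poly0 ef => /eqP.
    by rewrite size_poly_eq0 => /eqP ->; rewrite mulr0.
  apply: (can (k`_0 * c') g (c%:P * k')); first by rewrite mulf_neq0.
  have ek : k = (k`_0)%:P by apply: size1_polyC; rewrite -sk1.
  have e1 : c%:P * f = (k`_0)%:P * d by rewrite mul_polyC e {1}ek.
  have e2 : c'%:P * g = k' * d by rewrite mul_polyC.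
  by rewrite polyCM -mulrA e2 [f * _]mulrA [f * _]mulrC e1; ring.
have fact_mul (f g : {poly A}) :
    prime_product f -> prime_product g -> prime_product (f * g).
  move=> [s [u [uU sP ->]]] [t [v [vU tP ->]]].
  exists (s ++ t), (u * v); split; first by rewrite unitrM uU.
    by move=> p; rewrite mem_cat => /orP[/sP|/tP].
  by rewrite big_cat /=; ring.
have fact_prime (f : {poly A}) : prime_elt f -> prime_product f.
  move=> fp; exists [:: f], 1; split; first exact: unitr1.
    by move=> p; rewrite inE => /eqP ->.
  by rewrite big_seq1 mul1r.
move=> f; have [n] := ubnP (size f); elim: n f => // n IHn f sfn f0.
have lf0 : lead_coef f != 0 by rewrite lead_coef_eq0.
have [s [u [uU sP ls]]] := fA _ lf0.
have [k] := ubnP (size s).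
elim: k s u uU sP f sfn f0 lf0 ls => // k IHk s u uU sP f sfn f0 lf0 ls ssk.
have [[q [qp [g eg]]]|noq] := pselect (exists q : A, prime_elt q /\ rdvd q%:P f).
  have q0 : q != 0 by case: qp.
  have g0 : g != 0 by apply: contraNneq f0 => h; rewrite eg h mul0r.
  have [|s' [v [vU s'P lt eg']]] := @prime_cofactor A s q (u^-1 * lead_coef g) qp sP.
    move: ls; rewrite eg lead_coefM lead_coefC => ls.
    by rewrite -[LHS](mulKr uU) -ls; ring.
  rewrite eg; apply: fact_mul; last by exact/fact_prime/prime_elt_polyC.
  apply: (IHk s' (u * v)) => //; rewrite ?lead_coef_eq0 //.
  - by rewrite unitrM uU.
  - by move: sfn; rewrite eg mulrC mul_polyC size_scale.
  - by rewrite -mulrA -eg' mulrA divrr // mul1r.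
  - by apply: leq_trans lt _; rewrite -ltnS.
have [sf|sf] := leqP (size f) 1.
  have [t [v [vU tP ev]]] := fA _ lf0.
  exists (map polyC t), v%:P; split.
  - rewrite poly_unitE size_polyC coefC eqxx vU andbT; apply/eqP.
    by case: eqP vU => // ->; rewrite unitr0.
  - by move=> p /mapP[p' /tP ? ->]; exact: prime_elt_polyC.
  - rewrite big_map -rmorph_prod -polyCM -ev lead_coefE {1}(size1_polyC sf).
    by case: (size f) sf => [|[]].
have [irr|red] := pselect (irreducible_elt f).
  by apply/fact_prime/irr_prime => // q qp h; apply: noq; exists q.
have fU : f \isn't a GRing.unit by rewrite poly_unitE; case: (size f) sf => [|[]].
have [g [h [e gU hU]]] : exists g h,
    [/\ f = g * h, g \isn't a GRing.unit & h \isn't a GRing.unit].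
  apply: contrapT => nex; apply: red; split=> // y z e.
  have [?|yU] := boolP (y \is a GRing.unit); first by left.
  have [?|zU] := boolP (z \is a GRing.unit); first by right.
  by exfalso; apply: nex; exists y, z.
have nosmall (a b : {poly A}) : f = a * b -> a \isn't a GRing.unit -> (1 < size a)%N.
  move=> eab aU; rewrite ltnNge; apply/negP => sa.
  have a0 : a`_0 != 0.
    by apply: contraNneq f0 => h'; rewrite eab (size1_polyC sa) h' mul0r.
  have [t [v [vU tP ev]]] := fA _ a0.
  case: t => [|p t] in tP ev.
    move: aU; rewrite (size1_polyC sa) poly_unitE size_polyC a0 coefC eqxx ev.
    by rewrite big_nil mulr1 vU.
  apply: noq; exists p; split; first by apply: tP; rewrite mem_head.
  rewrite eab (size1_polyC sa) ev big_cons mulrCA !polyCM -mulrA.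
  exact/rdvdMr/rdvd_refl.
have sg := nosmall _ _ e gU; have sh := nosmall h g (etrans e (mulrC _ _)) hU.
have g0 : g != 0 by rewrite -size_poly_gt0; lia.
have h0 : h != 0 by rewrite -size_poly_gt0; lia.
have sfe : size f = (size g + size h).-1 by rewrite e size_mul.
by rewrite e; apply: fact_mul; apply: IHn => //; lia.
Qed.

(** * Multivariate polynomials as univariate ones *)

Section PolynomialRings.
Variables (n : nat) (R : comNzRingType).

Lemma mpoly_ring_ind (P : {mpoly R[n]} -> Prop) :
  (forall c, P c%:MP) -> (forall i, P 'X_i) ->
  (forall p q, P p -> P q -> P (p + q)) ->
  (forall p q, P p -> P q -> P (p * q)) -> forall p, P p.
Proof.
move=> PC PX PD PM p; rewrite [p]mpolyE.
have P0 : P 0 by rewrite -mpolyC0.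
have P1 : P 1 by rewrite -mpolyC1.
apply: (big_ind P P0 PD) => m _; rewrite -mul_mpolyC; apply: (PM) => //.
rewrite mpolyXE_id; apply: (big_ind P P1 PM) => i _.
by elim: (m i) => [|k IH]; rewrite ?expr0 // exprS; apply: (PM).
Qed.

Lemma mpoly_rmorph_ext (S : pzRingType) (phi psi : {rmorphism {mpoly R[n]} -> S}) :
  (forall c, phi c%:MP = psi c%:MP) -> (forall i, phi 'X_i = psi 'X_i) ->
  phi =1 psi.
Proof.
move=> eC eX x; elim/mpoly_ring_ind: x => // p q ep eq.
  by rewrite !rmorphD ep eq.
by rewrite !rmorphM ep eq.
Qed.

Lemma poly_rmorph_ext (T : nzRingType) (S : pzRingType)
    (phi psi : {rmorphism {poly T} -> S}) :
  (forall c, phi c%:P = psi c%:P) -> phi 'X = psi 'X -> phi =1 psi.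
Proof.
move=> eC eX x; elim/poly_ind: x => [|p c ep]; first by rewrite !rmorph0.
by rewrite !rmorphD !rmorphM eC eX ep.
Qed.

Lemma mmapU (S : nzRingType) (f : {rmorphism R -> S}) h i :
  mmap f h ('X_i : {mpoly R[n]}) = h i.
Proof. by rewrite mmapX mmap1U. Qed.

(** Chain rule, checked on constants and variables since both sides obey the Leibniz rule. It serves
    the derivative in one variable, the vector fields and the linear substitutions. *)
Lemma mmap_derivation (S : comNzRingType) (f : {rmorphism R -> S})
    (h : 'I_n -> S) (D : S -> S) :
  {morph D : x y / x + y} -> (forall x y, D (x * y) = D x * y + x * D y) ->
  (forall c, D (f c) = 0) ->
  forall q, D (mmap f h q) = \sum_(l < n) mmap f h q^`M(l) * D (h l).
Proof.
move=> DD DM Df q; elim/mpoly_ring_ind: q.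
- move=> c; rewrite mmapC Df big1 // => l _.
  by rewrite mderivC mmap0 mul0r.
- move=> i; rewrite mmapU (bigD1 i) //= big1 => [|l li].
    rewrite mderivX mnm1E eqxx scale1r.
    have -> : (U_(i) - U_(i) = 0 :> 'X_{1..n})%MM.
      by apply/mnmP => j; rewrite mnmBE subnn mnm0E.
    by rewrite mpolyX0 rmorph1 mul1r addr0.
  by rewrite mderivX mnm1E eq_sym (negbTE li) scale0r mmap0 mul0r.
- move=> p q ep eq; rewrite mmapD DD ep eq -big_split; apply: eq_bigr => l _.
  by rewrite mderivD mmapD mulrDl.
- move=> p q ep eq; rewrite rmorphM DM ep eq /= mulr_suml mulr_sumr -big_split.
  apply: eq_bigr => l _; rewrite mderivM mmapD !rmorphM /=; ring.
Qed.

End PolynomialRings.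

Section SplitVariable.
Variables (n : nat) (R : comNzRingType).

(** The distinguished variable is arbitrary because elimination is done with respect to the index of
    the row that df replaces in the tangent matrix. *)
Definition to_poly (k : 'I_n.+1) : {mpoly R[n.+1]} -> {poly {mpoly R[n]}} :=
  mmap (polyC \o @mpolyC n R)
    (fun i => if unlift k i is Some j then ('X_j)%:P else 'X).

HB.instance Definition _ k := GRing.RMorphism.on (to_poly k).

Definition lift_vars (k : 'I_n.+1) : {mpoly R[n]} -> {mpoly R[n.+1]} :=
  mmap (@mpolyC n.+1 R) (fun j => 'X_(lift k j)).

HB.instance Definition _ k := GRing.RMorphism.on (lift_vars k).

Definition of_poly (k : 'I_n.+1) : {poly {mpoly R[n]}} -> {mpoly R[n.+1]} :=
  horner_eval ('X_k) \o map_poly (lift_vars k).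

HB.instance Definition _ k := GRing.RMorphism.on (of_poly k).

Lemma of_polyC k c : of_poly k c%:P = lift_vars k c.
Proof. by rewrite /of_poly /= /horner_eval map_polyC hornerC. Qed.

Lemma of_polyX k : of_poly k 'X = 'X_k.
Proof. by rewrite /of_poly /= /horner_eval map_polyX hornerX. Qed.

Lemma to_polyU k i :
  to_poly k 'X_i = if unlift k i is Some j then ('X_j)%:P else 'X.
Proof. by rewrite [LHS]mmapX mmap1U. Qed.

Lemma to_polyC k c : to_poly k c%:MP = (c%:MP)%:P.
Proof. exact: mmapC. Qed.

Lemma lift_varsU k j : lift_vars k 'X_j = 'X_(lift k j).
Proof. by rewrite [LHS]mmapX mmap1U. Qed.

Lemma lift_varsC k c : lift_vars k c%:MP = c%:MP.
Proof. exact: mmapC. Qed.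

Lemma to_poly_lift k c : to_poly k (lift_vars k c) = c%:P.
Proof.
apply: (mpoly_rmorph_ext (phi := to_poly k \o lift_vars k) (psi := polyC)) => [d|i] /=.
  by rewrite lift_varsC to_polyC.
by rewrite lift_varsU to_polyU liftK.
Qed.

Lemma to_polyK k : cancel (to_poly k) (of_poly k).
Proof.
suff : of_poly k \o to_poly k =1 idfun by [].
apply: mpoly_rmorph_ext => [c|i].
  by rewrite [LHS]/= to_polyC of_polyC lift_varsC.
rewrite [LHS]/= to_polyU; case: unliftP => [j ->|->]; last by rewrite of_polyX.
by rewrite of_polyC lift_varsU.
Qed.

Lemma of_polyK k : cancel (of_poly k) (to_poly k).
Proof.
suff : to_poly k \o of_poly k =1 idfun by [].
apply: poly_rmorph_ext => [c|].
  by rewrite [LHS]/= of_polyC to_poly_lift.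
by rewrite [LHS]/= of_polyX to_polyU unlift_none.
Qed.

Lemma mmap_lift (S : comNzRingType) (f : {rmorphism R -> S}) h k c :
  mmap f h (lift_vars k c) = mmap f (h \o lift k) c.
Proof.
apply: (mpoly_rmorph_ext (phi := mmap f h \o lift_vars k)) => [d|i] /=.
  by rewrite lift_varsC !mmapC.
by rewrite lift_varsU !mmapU.
Qed.

Lemma mmap_of_poly (S : comNzRingType) (f : {rmorphism R -> S}) h k p :
  mmap f h (of_poly k p) = (map_poly (mmap f (h \o lift k)) p).[h k].
Proof.
apply: (poly_rmorph_ext (phi := mmap f h \o of_poly k)
  (psi := horner_eval (h k) \o map_poly (mmap f (h \o lift k)))) => [c|].
  by rewrite /= of_polyC mmap_lift /horner_eval map_polyC hornerC.
by rewrite /= of_polyX mmapU /horner_eval map_polyX hornerX.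
Qed.

Lemma to_poly_deriv k q : to_poly k q^`M(k) = (to_poly k q)^`().
Proof.
rewrite {2}/to_poly (@mmap_derivation _ _ {poly {mpoly R[n]}} _ _ (@deriv _)) /=.
- rewrite (bigD1 k) //= big1 => [|l lk]; first by rewrite unlift_none derivX mulr1 addr0.
  case: unliftP => [j _|e]; first by rewrite derivC mulr0.
  by rewrite e eqxx in lk.
- exact: derivD.
- exact: derivM.
- by move=> c; rewrite /= derivC.
Qed.

Lemma mderiv_lift k c : (lift_vars k c)^`M(k) = 0.
Proof.
by apply: (can_inj (to_polyK k)); rewrite to_poly_deriv to_poly_lift derivC rmorph0.
Qed.

Lemma size_to_poly_lift k q :
  (size (to_poly k q) <= 1)%N -> exists c, q = lift_vars k c.
Proof.
by move/size1_polyC => e; exists (to_poly k q)`_0; rewrite -of_polyC -e to_polyK.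
Qed.

End SplitVariable.

Lemma ufd_iso (A B : idomainType) (phi : {rmorphism A -> B})
    (psi : {rmorphism B -> A}) :
  cancel phi psi -> cancel psi phi -> ufd A -> ufd B.
Proof.
move=> phiK psiK fA x x0.
have y0 : psi x != 0 by rewrite -(inj_eq (can_inj phiK)) psiK rmorph0.
have [s [u [uU sP e]]] := fA _ y0.
exists (map phi s), (phi u); split; first exact: rmorph_unit.
  by move=> p /mapP[q /sP qp ->]; exact: prime_elt_iso qp.
by rewrite big_map -rmorph_prod -rmorphM -e psiK.
Qed.

Lemma mpoly_ufd (K : fieldType) n : ufd {mpoly K[n]}.
Proof.
elim: n => [|n IHn].
  move=> x x0; exists [::], x; rewrite big_nil mulr1; split=> //.
  have x00 : x@_0%MM != 0.
    by apply: contraNneq x0 => h; rewrite [x]nvar0_mpolyC h mpolyC0.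
  by apply/andP; rewrite unitfE x00 -nvar0_mpolyC eqxx.
pose A : idomainType := {poly {mpoly K[n]}}.
pose B : idomainType := {mpoly K[n.+1]}.
pose phi : {rmorphism A -> B} := @of_poly n K ord0.
pose psi : {rmorphism B -> A} := @to_poly n K ord0.
have phiK : cancel phi psi by move=> x; exact: of_polyK.
have psiK : cancel psi phi by move=> x; exact: to_polyK.
exact: (ufd_iso phiK psiK (poly_ufd IHn)).
Qed.

Lemma mpoly_irreducible_prime (K : fieldType) n (f : {mpoly K[n]}) :
  irreducible_elt f -> prime_elt f.
Proof. exact/ufd_irreducible/mpoly_ufd. Qed.

(** Characteristic zero supplies more natural numbers than [p] has roots. *)
Lemma poly_neq0_nonroot (K : numDomainType) (p : {poly K}) :
  p != 0 -> exists x, p.[x] != 0.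
Proof.
move=> p0; apply: contrapT => h.
have := max_poly_roots (rs := [seq i%:R | i <- iota 0 (size p)]) p0.
rewrite size_map size_iota ltnn => H; suff : false by [].
apply: H; first by apply/allP => x _; apply: contrapT => /negP hx; apply: h; exists x.
by rewrite map_inj_uniq ?iota_uniq // => i j /eqP; rewrite eqr_nat => /eqP.
Qed.

Lemma mpoly_neq0_nonroot (K : numDomainType) n (p : {mpoly K[n]}) :
  p != 0 -> exists v, p.@[v] != 0.
Proof.
elim: n p => [|n IHn] p p0.
  exists (fun=> 0); apply: contraNneq p0 => h.
  by move: h; rewrite [p]nvar0_mpolyC mevalC => ->; rewrite mpolyC0.
have y0 : to_poly ord0 p != 0.
  by rewrite -(inj_eq (can_inj (of_polyK ord0))) to_polyK rmorph0.
have [v hv] : exists v, (lead_coef (to_poly ord0 p)).@[v] != 0.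
  by apply: IHn; rewrite lead_coef_eq0.
have [|x hx] := @poly_neq0_nonroot K (map_poly (meval v) (to_poly ord0 p)).
  by apply: contraNneq hv => /polyP/(_ (size (to_poly ord0 p)).-1);
     rewrite coef_map coef0 lead_coefE => ->.
exists (fun i => if unlift ord0 i is Some j then v j else x).
rewrite -[p](to_polyK ord0) /meval mmap_of_poly unlift_none.
congr (_ != 0): hx; congr (_.[x]); apply: eq_map_poly => c /=.
by apply: meval_eq => j /=; rewrite liftK.
Qed.

Lemma mpoly_eval_ext (K : numDomainType) n (p q : {mpoly K[n]}) :
  (forall v, p.@[v] = q.@[v]) -> p = q.
Proof.
move=> h; apply/eqP; rewrite -subr_eq0; apply/contraT => /mpoly_neq0_nonroot[v].
by rewrite mevalB h subrr eqxx.
Qed.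

(** * Generic lines *)

(* Working with {mpoly A[n]} through this interface keeps the unification of
   algebraic structures on towers of polynomial rings tractable. *)
Record poly_extension (K : numDomainType) (A : idomainType) (n : nat) := PolyExtension {
  px_ring :> idomainType;
  px_cst : {rmorphism A -> px_ring};
  px_var : 'I_n -> px_ring;
  px_hom : forall S : comNzRingType,
    {rmorphism A -> S} -> ('I_n -> S) -> {rmorphism px_ring -> S};
  px_homC : forall (S : comNzRingType) (f : {rmorphism A -> S}) h c,
    px_hom f h (px_cst c) = f c;
  px_homU : forall (S : comNzRingType) (f : {rmorphism A -> S}) h j,
    px_hom f h (px_var j) = h j;
  px_ind : forall P : px_ring -> Prop,
    (forall c, P (px_cst c)) -> (forall i, P (px_var i)) ->
    (forall x y, P x -> P y -> P (x + y)) ->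
    (forall x y, P x -> P y -> P (x * y)) -> forall x, P x;
  px_prime : forall p, prime_elt p -> prime_elt (px_cst p);
  px_rdvd : forall p q, rdvd (px_cst p) (px_cst q) -> rdvd p q;
  px_nonroot : forall r : px_ring, r != 0 -> exists2 c : A, c != 0 &
    forall f : {rmorphism A -> K}, f c != 0 -> exists h, px_hom f h r != 0
}.

Lemma mpoly_extension (K : numDomainType) (A : idomainType) (n : nat) :
  poly_extension K A n.
Proof.
apply: (@PolyExtension K A n {mpoly A[n]} (@mpolyC n A) (fun j => 'X_j)
  (fun S f h => mmap f h)).
- by move=> S f h c; rewrite [LHS]mmapC.
- by move=> S f h j; rewrite [LHS]mmapX mmap1U.
- exact: mpoly_ring_ind.
- exact: prime_elt_mpolyC.
- move=> p q [c]; rewrite mulrC => /(congr1 (mcoeff 0%MM)) e; exists c@_0%MM.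
  by move: e; rewrite mcoeffC eqxx mulr1 mcoeffCM mulrC.
- move=> r r0; exists r@_(mlead r); first by rewrite mleadc_eq0.
  move=> f f0.
  have /mpoly_neq0_nonroot[a ha] : map_mpoly f r != 0.
    apply: contraNneq f0 => /mpolyP/(_ (mlead r)).
    by rewrite mcoeff_map_mpoly mcoeff0 => ->.
  exists a; congr (_ != 0): ha.
  apply: (mpoly_rmorph_ext (phi := meval a \o map_mpoly f)) => [c|i].
    by rewrite /= map_mpolyC mevalC mmapC.
  by rewrite /= map_mpolyX mevalXU mmapX mmap1U.
Qed.

Section GenericLines.
Variables (K : numClosedFieldType) (n : nat).
Implicit Types (f g : {mpoly K[n]}) (a b : 'I_n -> K).

Definition line_at a b z : 'I_n -> K := fun j => a j * z + b j.

(* The coordinate ring of the space of pairs (a, b): it is generated by the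
   coordinates of a over K[b]. *)
Definition pairs_ext : poly_extension K {mpoly K[n]} n := mpoly_extension K _ n.
Notation pairs_ring := (px_ring pairs_ext).
Notation pairs_cst := (px_cst pairs_ext).
Notation pairs_var := (px_var pairs_ext).
Notation pairs_hom := (px_hom pairs_ext).

Lemma pairs_rmorph_ext (S : pzRingType) (phi psi : {rmorphism pairs_ring -> S}) :
  (forall c, phi (pairs_cst c) = psi (pairs_cst c)) ->
  (forall i, phi (pairs_var i) = psi (pairs_var i)) -> phi =1 psi.
Proof.
move=> eC eX x; elim/px_ind: x => // x y ex ey.
  by rewrite !rmorphD ex ey.
by rewrite !rmorphM ex ey.
Qed.

Definition pair_eval a b : {rmorphism pairs_ring -> K} := pairs_hom (meval b) a.

(** Principal open sets suffice as witnesses: finite conjunctions become products of the polynomials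
    [r]. *)
Definition generic (P : ('I_n -> K) -> ('I_n -> K) -> Prop) : Prop :=
  exists r : pairs_ring, r != 0 /\ forall a b, pair_eval a b r != 0 -> P a b.

(** Two stages: [b] avoids the zeros of a nonzero coefficient of [r], then [a] is chosen for the
    specialized polynomial. *)
Lemma pair_eval_neq0 (r : pairs_ring) :
  r != 0 -> exists a b, pair_eval a b r != 0.
Proof.
move=> /px_nonroot[c /mpoly_neq0_nonroot[b hb] /(_ (meval b) hb)[a ha]].
by exists a, b.
Qed.

Lemma generic_exists P : generic P -> exists a b, P a b.
Proof. by case=> r [/pair_eval_neq0[a [b h]] H]; exists a, b; exact: H. Qed.

Lemma generic_and P Q : generic P -> generic Q -> generic (fun a b => P a b /\ Q a b).
Proof.
move=> [r [r0 rP]] [s [s0 sQ]]; exists (r * s); split; first by rewrite mulf_neq0.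
by move=> a b; rewrite rmorphM mulf_eq0 negb_or => /andP[/rP ? /sQ ?].
Qed.

Lemma generic_impl (P Q : _ -> _ -> Prop) :
  (forall a b, P a b -> Q a b) -> generic P -> generic Q.
Proof. by move=> PQ [r [r0 rP]]; exists r; split=> // a b /rP/PQ. Qed.

Lemma generic_forall (I : finType) (P : I -> _ -> _ -> Prop) :
  (forall i, generic (P i)) -> generic (fun a b => forall i, P i a b).
Proof.
move=> /choice[r rP]; exists (\prod_i r i); split.
  by apply/prodf_neq0 => i _; case: (rP i).
move=> a b; rewrite rmorph_prod => /prodf_neq0 h i.
by case: (rP i) => _; apply; exact: h.
Qed.

Lemma generic_if (Q : Prop) (P : _ -> _ -> Prop) :
  (Q -> generic P) -> generic (fun a b => Q -> P a b).
Proof.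
move=> h; have [/h|nQ] := pselect Q; first by apply: generic_impl => a b.
by exists 1; split=> [|a b _ /nQ//]; exact: oner_neq0.
Qed.

(** [pairs_cst 'X_j] is the coordinate b_j and [pairs_var j] is a_j, so this is f -> f(b + s a z),
    with z the variable ['X]. *)
Definition line_subst (s : {poly pairs_ring}) :
    {rmorphism {mpoly K[n]} -> {poly pairs_ring}} :=
  mmap (polyC \o (pairs_cst \o @mpolyC n K))
    (fun j => (pairs_cst 'X_j)%:P + s * (pairs_var j)%:P * 'X).

Definition shear_coef (s : {poly pairs_ring}) :
    {rmorphism pairs_ring -> {poly pairs_ring}} :=
  pairs_hom (line_subst s) (fun j => (pairs_var j)%:P).

(* The automorphism b |-> b + s a z of K[a, b, z], used for s = 1 and -1. *)
Definition shear (s : {poly pairs_ring}) :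
    {rmorphism {poly pairs_ring} -> {poly pairs_ring}} :=
  horner_eval 'X \o map_poly (shear_coef s).

Arguments line_subst : simpl never.
Arguments shear_coef : simpl never.
Arguments shear : simpl never.

Lemma shearC s c : shear s c%:P = shear_coef s c.
Proof. by rewrite /shear /= /horner_eval map_polyC hornerC. Qed.

Lemma shearX s : shear s 'X = 'X.
Proof. by rewrite /shear /= /horner_eval map_polyX hornerX. Qed.

Lemma shear_coefC s c : shear_coef s (pairs_cst c) = line_subst s c.
Proof. exact: px_homC. Qed.

Lemma shear_coefU s i : shear_coef s (pairs_var i) = (pairs_var i)%:P.
Proof. exact: px_homU. Qed.

Lemma line_substC s c : line_subst s c%:MP = (pairs_cst c%:MP)%:P.
Proof. by rewrite [LHS]mmapC. Qed.

Lemma line_substU s j : line_subst s 'X_j = (pairs_cst 'X_j)%:P + s * (pairs_var j)%:P * 'X.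
Proof. by rewrite [LHS]mmapX mmap1U. Qed.

(** Writing the sign as a power of -1 with a boolean exponent gives both inverse laws at once. *)
Lemma shearK (s : bool) : cancel (shear ((-1) ^+ s)) (shear ((-1) ^+ (~~ s))).
Proof.
suff : shear ((-1) ^+ (~~ s)) \o shear ((-1) ^+ s) =1 idfun by [].
have sN t u : shear t ((-1) ^+ u) = (-1) ^+ u by rewrite rmorphXn rmorphN1.
apply: poly_rmorph_ext => [c|]; last by rewrite -[LHS]/(shear _ (shear _ _)) !shearX.
rewrite -[LHS]/(shear _ _) shearC.
apply: (pairs_rmorph_ext (phi := shear ((-1) ^+ (~~ s)) \o shear_coef ((-1) ^+ s))
  (psi := polyC)) => [d|i]; last by rewrite -[LHS]/(shear _ _) shear_coefU shearC shear_coefU.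
rewrite -[LHS]/(shear _ _) shear_coefC.
apply: (mpoly_rmorph_ext (phi := shear ((-1) ^+ (~~ s)) \o line_subst ((-1) ^+ s))
  (psi := polyC \o pairs_cst)) => [e|i].
  by rewrite -[LHS]/(shear _ _) line_substC shearC shear_coefC line_substC.
rewrite -[LHS]/(shear _ _) line_substU rmorphD !rmorphM sN shearX !shearC shear_coefC.
rewrite line_substU shear_coefU.
by case: s; rewrite /= ?expr0 ?expr1 ?mulN1r ?mul1r ?mulNr ?addrK ?subrK.
Qed.

Definition line_poly := line_subst 1.

Lemma line_poly_shear f : line_poly f = shear ((-1) ^+ false) ((pairs_cst f)%:P).
Proof. by rewrite shearC shear_coefC expr0. Qed.

(** f(b + a z) is the image of the constant f(b) under an automorphism of K[a, b, z], and a prime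
    stays prime as a constant polynomial. *)
Lemma line_poly_prime f : prime_elt f -> prime_elt (line_poly f).
Proof.
move=> fp; rewrite line_poly_shear.
pose B : idomainType := {poly pairs_ring}.
pose phi : {rmorphism B -> B} := shear ((-1) ^+ false).
pose psi : {rmorphism B -> B} := shear ((-1) ^+ true).
have phiK : cancel phi psi by exact: shearK.
have psiK : cancel psi phi by exact: shearK.
apply: (prime_elt_iso phiK psiK).
exact/prime_elt_polyC/px_prime.
Qed.

Lemma line_poly_rdvd f g : rdvd (line_poly f) (line_poly g) -> rdvd f g.
Proof.
rewrite !line_poly_shear => /(rdvd_rmorph (shear ((-1) ^+ true))).
rewrite !(@shearK false) => -[c e]; apply: (@px_rdvd _ _ _ pairs_ext).
exists c`_0; move/(congr1 (fun p : {poly pairs_ring} => p`_0)): e.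
by rewrite coefMC !coefC.
Qed.

Lemma line_poly_eval f a b z :
  (map_poly (pair_eval a b) (line_poly f)).[z] = f.@[line_at a b z].
Proof.
apply: (mpoly_rmorph_ext (phi := horner_eval z \o (map_poly (pair_eval a b) \o line_poly))
  (psi := meval (line_at a b z))) => [c|j].
  rewrite -[LHS]/((map_poly (pair_eval a b) (line_subst 1 _)).[z]) line_substC.
  by rewrite map_polyC hornerC /= /pair_eval px_homC [LHS]mevalC [RHS]mevalC.
rewrite -[LHS]/((map_poly (pair_eval a b) (line_subst 1 _)).[z]) line_substU mul1r.
rewrite rmorphD rmorphM /= !map_polyC map_polyX /= [RHS]mevalXU.
rewrite /pair_eval px_homC px_homU; set t := (meval b : {rmorphism _ -> _}) _.
have -> : t = b j by exact: mevalXU.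
by rewrite !hornerE /line_at addrC.
Qed.

(** If z did not occur, evaluating at z = 0 and z = 1 on the lines through the origin would give
    f(v) = f(0) for all v, and [f] would be a unit. *)
Lemma line_poly_size f : prime_elt f -> (1 < size (line_poly f))%N.
Proof.
move=> [f0 fU _]; rewrite ltnNge; apply/negP => sf; move/negP: fU; apply.
have fe v : f.@[v] = f.@[fun=> 0].
  have := line_poly_eval f v (fun=> 0) 0; have := line_poly_eval f v (fun=> 0) 1.
  rewrite (size1_polyC sf) map_polyC !hornerC => -> e.
  congr (_ = _): e; apply: meval_eq => j; by rewrite /line_at ?mulr1 ?mulr0 ?addr0.
have ef : f = (f.@[fun=> 0])%:MP by apply: mpoly_eval_ext => v; rewrite mevalC fe.
have c0 : f.@[fun=> 0] != 0.
  by apply: contraNneq f0 => h; rewrite ef h mpolyC0.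
by rewrite ef; apply: rmorph_unit; rewrite unitfE.
Qed.

(** Where the leading coefficient in z survives specialization, the degree stays positive and the
    algebraically closed field supplies a root. *)
Lemma generic_root f : prime_elt f ->
  generic (fun a b => exists z, f.@[line_at a b z] = 0).
Proof.
move=> fp; have sf := line_poly_size fp.
exists (lead_coef (line_poly f)); split.
  by rewrite lead_coef_eq0 -size_poly_gt0; apply: leq_trans sf.
move=> a b h.
have /closed_rootP[z /rootP hz] : size (map_poly (pair_eval a b) (line_poly f)) != 1%N.
  by rewrite size_poly_eq //; move: sf; case: (size _) => [|[]].
by exists z; rewrite -line_poly_eval.
Qed.

(** The Bezout constant [r] combines f and g along the universal line, so it vanishes at every (a,
    b) whose line carries a common zero. *)
Lemma generic_no_common_root f g : prime_elt f -> ~ rdvd f g ->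
  generic (fun a b => forall z, f.@[line_at a b z] = 0 -> g.@[line_at a b z] != 0).
Proof.
move=> fp fg.
have nd : ~ rdvd (line_poly f) (line_poly g) by move/line_poly_rdvd.
have [u [v [r [r0 e]]]] := prime_Bezout (line_poly_prime fp) (line_poly_size fp) nd.
exists r; split=> // a b h z f0; apply: contraNneq h => g0.
move/(congr1 (fun p => (map_poly (pair_eval a b) p).[z])): e.
rewrite map_polyC hornerC rmorphD !rmorphM /= !hornerE !line_poly_eval f0 g0.
by rewrite !mulr0 addr0 => <-.
Qed.

(** Nullstellensatz for a prime hypersurface: if [f] did not divide [g], a generic line would meet f
    = 0 at points where [g] is nonzero. *)
Lemma prime_vanishing f g : prime_elt f ->
  (forall v, f.@[v] = 0 -> g.@[v] = 0) -> rdvd f g.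
Proof.
move=> fp fg; apply: contrapT => nfg.
have [a [b [[z fz] h]]] := generic_exists
  (generic_and (generic_root fp) (generic_no_common_root fp nfg)).
by move: (h z fz); rewrite fg // eqxx.
Qed.

End GenericLines.

(** * Vector fields and the Jacobian criterion *)

Lemma prime_det_ker (A : idomainType) (f : A) n (M : 'M[A]_n) :
  prime_elt f -> rdvd f (\det M) ->
  exists2 v : 'cV[A]_n, (exists i, ~ rdvd f (v i 0)) &
    forall i, rdvd f ((M *m v) i 0).
Proof.
move=> fp fM; have [Q [rho [ker surj]]] := prime_quotient fp.
have /det0P[v v0 vM] : \det (map_mx rho M^T) == 0.
  by rewrite det_map_mx det_tr; apply/eqP/ker.
have [w wE] := choice (fun j => surj (v 0 j)).
exists (\col_j w j).
  case/rV0Pn: v0 => i vi; exists i; rewrite mxE => /ker; rewrite wE => h.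
  by rewrite h eqxx in vi.
move=> i; apply/ker; move/rowP/(_ i): vM; rewrite !mxE rmorph_sum => e.
by rewrite -[RHS]e; apply: eq_bigr => j _; rewrite rmorphM !mxE wE mulrC.
Qed.

Lemma rdvd_horner (A : idomainType) (p : {poly A}) x : rdvd x (p.[x] - p`_0).
Proof.
elim/poly_ind: p => [|p c _]; first by rewrite horner0 coef0 subrr; exact: rdvd0.
rewrite hornerMXaddC coefD coefMX coefC eqxx add0r addrK.
exact/rdvdMl/rdvd_refl.
Qed.

Section Derivations.
Variables (K : numFieldType) (m n : nat).

Definition subst (w : 'I_m -> {mpoly K[n]}) :
    {rmorphism {mpoly K[m]} -> {mpoly K[n]}} := mmap (@mpolyC n K) w.

Definition vder (Y : 'cV[{mpoly K[n]}]_n) (g : {mpoly K[n]}) : {mpoly K[n]} :=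
  \sum_j Y j 0 * g^`M(j).

Lemma vderD Y : {morph vder Y : x y / x + y}.
Proof.
move=> x y; rewrite /vder -big_split; apply: eq_bigr => j _.
by rewrite mderivD mulrDr.
Qed.

Lemma vderM Y x y : vder Y (x * y) = vder Y x * y + x * vder Y y.
Proof.
rewrite /vder mulr_suml mulr_sumr -big_split; apply: eq_bigr => j _ /=.
by rewrite mderivM; ring.
Qed.

Lemma vderC Y c : vder Y c%:MP = 0.
Proof. by apply: big1 => j _; rewrite mderivC mulr0. Qed.

Lemma vderU Y i : vder Y 'X_i = Y i 0.
Proof.
rewrite /vder (bigD1 i) //= big1 => [|j ji].
  rewrite mderivX mnm1E eqxx scale1r addr0.
  have -> : (U_(i) - U_(i) = 0 :> 'X_{1..n})%MM.
    by apply/mnmP => j; rewrite mnmBE subnn mnm0E.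
  by rewrite mpolyX0 mulr1.
by rewrite mderivX mnm1E eq_sym (negbTE ji) scale0r mulr0.
Qed.

Lemma vder_subst Y w q :
  vder Y (subst w q) = \sum_l subst w q^`M(l) * vder Y (w l).
Proof.
apply: (mmap_derivation (f := @mpolyC n K) w (vderD Y)); first exact: vderM.
exact: vderC.
Qed.

Lemma rdvd_vder Y (f g : {mpoly K[n]}) :
  rdvd f (vder Y f) -> rdvd f g -> rdvd f (vder Y g).
Proof.
move=> fY [c ->]; rewrite vderM; apply: rdvdD; last exact: rdvdMl.
exact/rdvdMl/rdvd_refl.
Qed.

Lemma vderXn Y g k : vder Y (g ^+ k) = k%:R * g ^+ k.-1 * vder Y g.
Proof.
elim: k => [|k IH]; first by rewrite expr0 -mpolyC1 vderC !mul0r.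
rewrite exprS vderM IH /=; case: k {IH} => [|k] /=; first by rewrite !expr0; ring.
by rewrite exprS -[k.+2]addn1 natrD; ring.
Qed.

Lemma tangent_mulE (p : 'I_n -> {mpoly K[n]}) (Y : 'cV_n) i :
  \sum_j (p i)^`M(j) * Y j 0 = vder Y (p i).
Proof. by apply: eq_bigr => j _; rewrite mulrC. Qed.

End Derivations.

(** * Arguments by least degree, and algebraic dependence *)

Section Degrees.
Variables (K : numFieldType) (n : nat).
Implicit Types p q : {mpoly K[n]}.

Lemma mpoly_mulrn_eq0 p k : p *+ k.+1 = 0 -> p = 0.
Proof.
move/mpolyP => h; apply/mpolyP => m; rewrite mcoeff0.
by move: (h m); rewrite mcoeffMn mcoeff0 => /eqP; rewrite mulrn_eq0 => /eqP.
Qed.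

Lemma mderiv_eq0_const q : (forall l, q^`M(l) = 0) -> q = (q@_0%MM)%:MP.
Proof.
move=> h; apply/mpolyP => m; rewrite mcoeffC; have [->|m0] := eqVneq m 0%MM.
  by rewrite mulr1.
rewrite mulr0; have [l ml] : exists l, m l != 0%N.
  apply: contrapT => nl; move/eqP: m0; apply; apply/mnmP => l; rewrite mnm0E.
  by apply: contrapT => hl; apply: nl; exists l; apply/eqP.
have := congr1 (mcoeff (m - U_(l))%MM) (h l); rewrite mcoeff_deriv mcoeff0.
by rewrite submK ?lep1mP // => /eqP; rewrite mulrn_eq0 => /eqP.
Qed.

Lemma msize_mderiv q l : q != 0 -> (msize q^`M(l) < msize q)%N.
Proof.
move=> q0; have [->|d0] := eqVneq q^`M(l) 0.
  by rewrite msize0 lt0n msize_poly_eq0.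
rewrite -mlead_deg //; have := mlead_supp d0.
rewrite mcoeff_msupp mcoeff_deriv; set m := mlead _ => h.
have : (m + U_(l))%MM \in msupp q.
  by rewrite mcoeff_msupp; apply: contraNneq h => ->; rewrite mul0rn.
by move/msize_mdeg_lt; rewrite mdegD mdeg1 addn1.
Qed.

Lemma exists_min_msize (P : {mpoly K[n]} -> Prop) : (exists h, P h) ->
  exists2 h, P h & forall g, P g -> (msize h <= msize g)%N.
Proof.
move=> [h0 Ph0]; have ex : exists k, `[<exists2 h, P h & msize h = k>].
  by exists (msize h0); apply/asboolP; exists h0.
case: (ex_minnP ex) => k /asboolP[h Ph <-] kmin; exists h => // g Pg.
by apply: kmin; apply/asboolP; exists g.
Qed.

(* A nonzero element of least degree of a prime ideal is irreducible. *)
Lemma exists_prime_in (P : {mpoly K[n]} -> Prop) :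
  (exists2 h, h != 0 & P h) -> (forall c, P c%:MP -> c = 0) ->
  (forall g h, P (g * h) -> P g \/ P h) -> exists2 h, prime_elt h & P h.
Proof.
move=> [h0 h00 Ph0] Pc PM.
have [|h [hn0 Ph] hmin] := @exists_min_msize (fun h => h != 0 /\ P h).
  by exists h0.
exists h => //; apply: mpoly_irreducible_prime; split=> //.
  apply/negP => /andP[/eqP eh _]; move: hn0; rewrite eh mpolyC_eq0.
  by rewrite (Pc h@_0%MM) ?eqxx // -eh.
have uni (y : {mpoly K[n]}) : y != 0 -> (msize y <= 1)%N -> y \is a GRing.unit.
  move=> y0 /msize1_polyC ey; rewrite ey; apply: rmorph_unit; rewrite unitfE.
  by apply: contraNneq y0 => e; rewrite ey e mpolyC0.
move=> y z e; have y0 : y != 0 by apply: contraNneq hn0 => e'; rewrite e e' mul0r.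
have z0 : z != 0 by apply: contraNneq hn0 => e'; rewrite e e' mulr0.
have se : msize h = (msize y + msize z).-1 by rewrite e msizeM.
have sy : (0 < msize y)%N by rewrite lt0n msize_poly_eq0.
have sz : (0 < msize z)%N by rewrite lt0n msize_poly_eq0.
case: (PM y z); first by rewrite -e.
  move=> Py; right; apply: uni => //; have := hmin y (conj y0 Py).
  by rewrite se; move: sy sz; clear; move: (msize y) (msize z); lia.
move=> Pz; left; apply: uni => //; have := hmin z (conj z0 Pz).
by rewrite se; move: sy sz; clear; move: (msize y) (msize z); lia.
Qed.

End Degrees.

Lemma msizeM_pred (K : idomainType) n (p q : {mpoly K[n]}) :
  ((msize (p * q)).-1 <= (msize p).-1 + (msize q).-1)%N.
Proof.
have [->|p0] := eqVneq p 0; first by rewrite mul0r msize0.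
have [->|q0] := eqVneq q 0; first by rewrite mulr0 msize0.
rewrite msizeM //; move: p0 q0; rewrite -!msize_poly_eq0 -!lt0n.
by move: (msize p) (msize q); clear; lia.
Qed.

Lemma wide_left_ker (K : fieldType) m n (A : 'M[K]_(m, n)) :
  (n < m)%N -> exists2 u : 'rV_m, u != 0 & u *m A = 0.
Proof.
move=> nm; have /rowV0Pn[u /sub_kermxP uA u0] : kermx A != 0.
  rewrite kermx_eq0 /row_free; apply: contraL nm => /eqP <-.
  by rewrite -leqNgt rank_leq_col.
by exists u.
Qed.

(* Compare the number of monomials in the w_i with exponents below d with the
   number of monomials in m variables that can occur in them. *)
Lemma algebraic_dependence (K : numFieldType) m (w : 'I_m.+1 -> {mpoly K[m]}) :
  exists2 H : {mpoly K[m.+1]}, H != 0 & subst w H = 0.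
Proof.
pose e := \max_i msize (w i).
(* There are d^(m+1) monomials in the [w i] against D^m = (E d)^m exponent vectors, and d > E^m
   makes the former more numerous. [E] is chosen so that the degree bound (m+1)(d-1)e stays below
   D. *)
pose E := (m.+1 * e).+1; pose d := (E ^ m).+1; pose D := (E * d)%N.
pose I := {ffun 'I_m.+1 -> 'I_d}; pose J := {ffun 'I_m -> 'I_D}.
pose mI (a : I) : 'X_{1..m.+1} := [multinom (a i : nat) | i < m.+1].
pose mJ (a : J) : 'X_{1..m} := [multinom (a i : nat) | i < m].
pose A := \matrix_(i < #|I|, j < #|J|) (subst w 'X_[mI (enum_val i)])@_(mJ (enum_val j)).
have cIJ : (#|J| < #|I|)%N.
  rewrite !card_ffun !card_ord /D expnMn expnS.
  by rewrite ltn_pmul2r ?expn_gt0 //.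
have [u u0 uA] := wide_left_ker A cIJ.
exists (\sum_(i < #|I|) u 0 i *: 'X_[mI (enum_val i)]).
  case/rV0Pn: u0 => i ui; apply: contraNneq ui => /mpolyP/(_ (mI (enum_val i))).
  rewrite mcoeff0 raddf_sum /= (bigD1 i) //= mcoeffZ mcoeffX eqxx mulr1.
  rewrite big1 ?addr0 => [->//|j ji].
  rewrite mcoeffZ mcoeffX; case: eqP => [h|_]; last by rewrite mulr0.
  suff /enum_val_inj ij : enum_val j = enum_val i by rewrite ij eqxx in ji.
  apply/ffunP => k; apply/val_inj; move/mnmP/(_ k): h.
  by rewrite !mnmE.
have sz i : ((msize (subst w 'X_[mI i])).-1 < D)%N.
  have h (s : seq 'I_m.+1) :
      ((msize (\prod_(k <- s) w k ^+ mI i k)).-1 <= \sum_(k <- s) d.-1 * e)%N.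
    elim: s => [|k s IH]; first by rewrite !big_nil msize1.
    rewrite !big_cons; apply: leq_trans (msizeM_pred _ _) _; apply: leq_add => //.
    have he : ((msize (w k)).-1 <= e)%N.
      by apply: leq_trans (leq_pred _) _; exact: (@leq_bigmax _ (fun k => msize (w k))).
    have le : (mI i k <= d.-1)%N by rewrite mnmE -ltnS ltn_ord.
    apply: leq_trans (leq_mul le he); elim: (mI i k) => [|c IHc].
      by rewrite expr0 msize1.
    by rewrite exprS mulSn; apply: leq_trans (msizeM_pred _ _) _; exact: leq_add.
  have -> : subst w 'X_[mI i] = \prod_(k < m.+1) w k ^+ mI i k by rewrite [LHS]mmapX.
  apply: leq_ltn_trans (h _) _; rewrite sum_nat_const card_ord /D /E /=.
  rewrite /d /= ; move: (E ^ m)%N; clear; move=> x.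
  by rewrite mulnS mulSn mulnCA mulnA; nia.
rewrite raddf_sum; apply/mpolyP => k; rewrite mcoeff0 raddf_sum /=.
have [kD|kD] := leqP D (mdeg k).
  apply: big1 => i _; rewrite -mul_mpolyC rmorphM /=.
  have -> : subst w (u 0 i)%:MP = (u 0 i)%:MP by rewrite [LHS]mmapC.
  rewrite mcoeffCM memN_msupp_eq0 ?mulr0 //; apply: msize_mdeg_ge.
  by apply: leq_trans kD; move: (sz (enum_val i)); case: (msize _).
have kl l : (k l < D)%N.
  by apply: leq_ltn_trans kD; rewrite mdegE (bigD1 l) //= leq_addr.
pose a : J := [ffun l => Ordinal (kl l)].
have -> : k = mJ a by apply/mnmP => l; rewrite mnmE ffunE.
move/rowP/(_ (enum_rank a)): uA; rewrite !mxE => uA; rewrite -[RHS]uA.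
apply: eq_bigr => i _; rewrite mxE enum_rankK -mul_mpolyC rmorphM /=.
have -> : subst w (u 0 i)%:MP = (u 0 i)%:MP by rewrite [LHS]mmapC.
by rewrite mcoeffCM.
Qed.

(** * Relations modulo f when the rank is full *)

Section Hypersurface.
Variables (K : numFieldType) (n : nat).
Implicit Types (f g h q : {mpoly K[n.+1]}) (w p : 'I_n.+1 -> {mpoly K[n.+1]}).

(** The n+1 polynomials [w] and [f] itself are n+2 elements in n+1 variables, hence satisfy a
    relation. Dividing it by the largest power of the variable standing for [f] and then setting
    this variable to zero gives [P]. *)
Lemma relation_mod f w : f != 0 ->
  exists2 P : {mpoly K[n.+1]}, P != 0 & rdvd f (subst w P).
Proof.
move=> f0.
pose w' (i : 'I_n.+2) := if unlift ord0 i is Some j then w j else f.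
have [H H0 eH] := algebraic_dependence w'.
have T0 : to_poly ord0 H != 0.
  by rewrite -(inj_eq (can_inj (of_polyK ord0))) to_polyK rmorph0.
have w'E : w' \o lift ord0 = w by apply/funext => j; rewrite /w' /= liftK.
have := eH; rewrite -[H](to_polyK ord0) [subst _ _]mmap_of_poly w'E /w' unlift_none.
have [k [q q0 ->]] := multiplicity_XsubC (to_poly ord0 H) 0.
rewrite subr0 rmorphM rmorphXn /= map_polyX hornerM hornerXn => /eqP.
rewrite mulf_eq0 expf_eq0 (negbTE f0) andbF orbF => /eqP e.
exists q`_0; first by move: q0; rewrite T0 rootE horner_coef0.
have := rdvd_horner (map_poly (mmap (@mpolyC n.+1 K) w) q) f.
by rewrite e sub0r coef_map => /rdvdN; rewrite opprK.
Qed.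

Definition replace (p : 'I_n.+1 -> {mpoly K[n.+1]}) (k : 'I_n.+1)
    (f : {mpoly K[n.+1]}) : 'I_n.+1 -> {mpoly K[n.+1]} :=
  fun j => if j == k then f else p j.

(** When [f] divides the Jacobian, the only maximal minors of the tangent matrix augmented by df
    that can survive modulo [f] are those in which df replaces some row k. *)
Definition tangent_rank (p : 'I_n.+1 -> {mpoly K[n.+1]}) f : Prop :=
  exists k, ~ rdvd f (\det (tangent_mx (replace p k f))).

Lemma deriv_eq0_size (s : {poly {mpoly K[n]}}) : s^`() = 0 -> (size s <= 1)%N.
Proof.
move/polyP => h; apply/leq_sizeP => -[//|i] _.
by move: (h i); rewrite coef_deriv coef0; exact: mpoly_mulrn_eq0.
Qed.

Lemma mderiv_eq0_lift k q : q^`M(k) = 0 -> exists c, q = lift_vars k c.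
Proof.
by move=> h; apply/size_to_poly_lift/deriv_eq0_size; rewrite -to_poly_deriv h rmorph0.
Qed.

Lemma tangent_mulmx p (Y : 'cV_n.+1) i : (tangent_mx p *m Y) i 0 = vder Y (p i).
Proof. by rewrite mxE -tangent_mulE; apply: eq_bigr => j _; rewrite mxE. Qed.

(* Differentiate a relation of least degree along the vector fields given by
   the columns of the adjugate. *)
Lemma no_relation p f k q : prime_elt f ->
  ~ rdvd f (\det (tangent_mx (replace p k f))) ->
  q^`M(k) = 0 -> rdvd f (subst p q) -> q = 0.
Proof.
move=> fp fD; have [N] := ubnP (msize q); elim: N q => // N IHN q sq qk fq.
have [//|q0] := eqVneq q 0.
have dq l : q^`M(l) = 0.
  have [->//|lk] := eqVneq l k.
  apply: IHN; first by apply: leq_trans (msize_mderiv l q0) _; rewrite -ltnS.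
    by rewrite mderiv_comm qk mderiv0.
  (* Column l of the adjugate kills f, which sits in row k, and every p_j with j different from k
     and l, and sends p_l to det M. As q does not involve the variable k, applying this column to
     q(p) leaves det M times the l-th derivative of q at p. *)
  pose M := tangent_mx (replace p k f); pose Y := col l (\adj M).
  have YE j : vder Y (replace p k f j) = \det M *+ (j == l).
    rewrite -tangent_mulmx /Y colE mulmxA mul_mx_adj mul_scalar_mx !mxE eqxx andbT.
    by case: eqP => _; rewrite ?mulr1 ?mulr0.
  have Yf : vder Y f = 0.
    by have := YE k; rewrite /replace eqxx eq_sym (negbTE lk).
  have := rdvd_vder (Y := Y) _ fq; rewrite Yf vder_subst => /(_ (rdvd0 f)).
  rewrite (bigD1 l) //= big1 ?addr0 => [|j jl].
    have := YE l; rewrite /replace (negbTE lk) eqxx => ->.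
    by case: fp => _ _ h /h [].
  have [->|jk] := eqVneq j k; first by rewrite qk rmorph0 mul0r.
  by have := YE j; rewrite /replace (negbTE jk) (negbTE jl) => ->; rewrite mulr0.
have qc := mderiv_eq0_const dq; move: fq; rewrite qc [subst _ _]mmapC => -[c ec].
have [->|c0] := eqVneq q@_0%MM 0; first by rewrite mpolyC0.
have := @prime_eltU _ _ (q@_0%MM)%:MP fp (ex_intro _ c ec).
by rewrite (rmorph_unit (@mpolyC n.+1 K)) // unitfE.
Qed.

(** A prime relation [h] must involve the variable k by [no_relation]. If it did not divide another
    relation q, eliminating that variable between [h] and q would give a nonzero relation free of
    it. *)
Lemma relations_principal p f : prime_elt f -> tangent_rank p f ->
  exists h, [/\ prime_elt h, rdvd f (subst p h) &
    forall q, rdvd f (subst p q) -> rdvd h q].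
Proof.
move=> fp [k fk]; have [f0 fU fM] := fp.
have [|||h hp fh] := @exists_prime_in K n.+1 (fun q => rdvd f (subst p q)).
- by have [P P0 fP] := relation_mod p f0; exists P.
- move=> c; rewrite [subst _ _]mmapC => fc; apply/eqP; apply/contraT => c0.
  have := prime_eltU fp fc; rewrite (rmorph_unit (@mpolyC n.+1 K)) //.
  by rewrite unitfE.
- by move=> g h; rewrite rmorphM => /fM.
exists h; split=> // q fq; apply: contrapT => hq.
have [h0 _ _] := hp.
have sh : (1 < size (to_poly k h))%N.
  rewrite ltnNge; apply/negP => /size_to_poly_lift[c ec].
  move/eqP: h0; apply; apply: (no_relation fp fk) => //.
  by rewrite ec mderiv_lift.
pose A : idomainType := {mpoly K[n.+1]}.
pose B : idomainType := {poly {mpoly K[n]}}.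
pose phi : {rmorphism A -> B} := @to_poly n K k.
pose psi : {rmorphism B -> A} := @of_poly n K k.
have phiK : cancel phi psi by move=> x; exact: to_polyK.
have psiK : cancel psi phi by move=> x; exact: of_polyK.
pose sigma : {rmorphism A -> A} := subst p.
have [r r0 fr] := @prime_eliminate A A _ phi psi sigma f h q phiK psiK hp sh hq fh fq.
have : lift_vars k r = 0.
  apply: (no_relation fp fk); first exact: mderiv_lift.
  by rewrite -of_polyC.
move/(congr1 (to_poly k)); rewrite to_poly_lift rmorph0 => /eqP.
by rewrite polyC_eq0 (negbTE r0).
Qed.

End Hypersurface.

(** * Full rank from a principal bound on the relations, and tangent kernel fields *)

Section HypersurfaceConverse.
Variables (K : numFieldType) (n : nat).
Implicit Types (f g h q : {mpoly K[n.+1]}) (w p : 'I_n.+1 -> {mpoly K[n.+1]}).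

Lemma prime_elt_mderiv h : prime_elt h -> exists k, h^`M(k) != 0.
Proof.
move=> [h0 hU _]; apply: contrapT => nk.
have : h = (h@_0%MM)%:MP.
  apply: mderiv_eq0_const => l; apply: contrapT => hl.
  by apply: nk; exists l; apply/eqP.
move=> eh; move/negP: hU; apply; rewrite eh; apply: rmorph_unit.
by rewrite unitfE; apply: contraNneq h0 => e; rewrite eh e mpolyC0.
Qed.

Lemma rdvd_mderiv_eq0 k h q : q != 0 -> rdvd h q -> q^`M(k) = 0 -> h^`M(k) = 0.
Proof.
move=> q0 hq qk; pose A : idomainType := {mpoly K[n.+1]}.
pose B : idomainType := {poly {mpoly K[n]}}.
pose phi : {rmorphism A -> B} := @to_poly n K k.
have Tq0 : phi q != 0.
  by rewrite -(inj_eq (can_inj (of_polyK k))) to_polyK rmorph0.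
have sq : (size (phi q) <= 1)%N.
  by apply: deriv_eq0_size; rewrite -to_poly_deriv qk rmorph0.
have sh := size_rdvd_le1 Tq0 (rdvd_rmorph phi hq) sq.
by have [c ->] := size_to_poly_lift sh; exact: mderiv_lift.
Qed.

(* Each coordinate is algebraic over the p_j, j <> k, modulo f; a vector field
   tangent to f = 0 and killing those p_j modulo f therefore vanishes on f = 0. *)
Lemma tangent_rank_of_principal p f h : prime_elt f -> prime_elt h ->
  (forall q, rdvd f (subst p q) -> rdvd h q) -> tangent_rank p f.
Proof.
move=> fp hp fh; have [f0 fU fM] := fp.
have [k hk] := prime_elt_mderiv hp; exists k => fD.
(* The p_j with j different from k are independent modulo f: every relation is a multiple of h, and
   h involves the variable k. *)
have indep q : q != 0 -> q^`M(k) = 0 -> ~ rdvd f (subst p q).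
  move=> q0 qk /fh hq; move/eqP: hk; apply; exact: rdvd_mderiv_eq0 q0 hq qk.
have [Y [l Yl] YM] := prime_det_ker fp fD; apply: Yl.
have Yr j : rdvd f (vder Y (replace p k f j)) by rewrite -tangent_mulmx.
have Yf : rdvd f (vder Y f) by have := Yr k; rewrite /replace eqxx.
have Yp j : j != k -> rdvd f (vder Y (p j)).
  by move=> jk; have := Yr j; rewrite /replace (negbTE jk).
(* A relation P of least degree between x_l and these p_j involves the variable k by [indep], and by
   minimality its k-th derivative is not a relation. Applying Y leaves this derivative times the
   entry Y_l. *)
pose w := replace p k 'X_l.
have wE : w \o lift k = p \o lift k.
  by apply/funext => j; rewrite /w /replace /= eq_sym (negbTE (neq_lift k j)).
have [P0 P00 fP0] := relation_mod w f0.
have [|P [Pn0 fP] Pmin] :=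
    @exists_min_msize K n.+1 (fun P => P != 0 /\ rdvd f (subst w P)).
  by exists P0.
have Pk : P^`M(k) != 0.
  apply/eqP => Pk; have [c eP] := mderiv_eq0_lift Pk.
  apply: (indep P Pn0 Pk); move: fP.
  have e v : subst v P = mmap (@mpolyC n.+1 K) (v \o lift k) c.
    by rewrite eP [LHS]mmap_lift.
  by rewrite !e wE.
have dP : ~ rdvd f (subst w P^`M(k)).
  move=> d; have := Pmin _ (conj Pk d).
  by rewrite leqNgt msize_mderiv.
have := rdvd_vder Yf fP; rewrite vder_subst (bigD1 k) //=.
have fS : rdvd f (\sum_(i < n.+1 | i != k) subst w P^`M(i) * vder Y (w i)).
  apply: rdvd_sum => i ik; apply: rdvdMl.
  by rewrite /w /replace (negbTE ik); exact: Yp.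
move=> fs; have := rdvdB fs fS; rewrite addrK.
have -> : w k = 'X_l by rewrite /w /replace eqxx.
by rewrite vderU => /fM[].
Qed.

(** A dependency u between the rows of the tangent matrix modulo [f] has a coefficient u_k nonzero
    modulo [f]. Failure of the rank condition at this k gives Y killing f and the other p_j; the
    dependency then handles p_k. *)
Lemma tangent_kernel p f : prime_elt f -> rdvd f (\det (tangent_mx p)) ->
  ~ tangent_rank p f ->
  exists Y : 'cV_n.+1, [/\ exists i, ~ rdvd f (Y i 0),
    forall i, rdvd f (vder Y (p i)) & rdvd f (vder Y f)].
Proof.
move=> fp fJ nR; have [_ _ fM] := fp.
have [|u [k uk] uJ] := @prime_det_ker _ f _ (tangent_mx p)^T fp.
  by rewrite det_tr.
have fD : rdvd f (\det (tangent_mx (replace p k f))).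
  by apply: contrapT => h; apply: nR; exists k.
have [Y Yn YM] := prime_det_ker fp fD.
have Yr j : rdvd f (vder Y (replace p k f j)) by rewrite -tangent_mulmx.
have Yp j : j != k -> rdvd f (vder Y (p j)).
  by move=> jk; have := Yr j; rewrite /replace (negbTE jk).
exists Y; split=> //; last by have := Yr k; rewrite /replace eqxx.
move=> i; have [->|] := eqVneq i k; last exact: Yp.
suff : rdvd f (u k 0 * vder Y (p k)) by case/fM.
have fS : rdvd f (\sum_l u l 0 * vder Y (p l)).
  have -> : \sum_l u l 0 * vder Y (p l) = \sum_j Y j 0 * ((tangent_mx p)^T *m u) j 0.
    rewrite (eq_bigr (fun l => \sum_j Y j 0 * ((tangent_mx p)^T j l * u l 0))).
      by rewrite exchange_big; apply: eq_bigr => j _; rewrite !mxE mulr_sumr.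
    move=> l _; rewrite /vder mulr_sumr; apply: eq_bigr => j _.
    by rewrite !mxE; ring.
  by apply: rdvd_sum => j _; exact: rdvdMl.
move: fS; rewrite (bigD1 k) //= => fS.
have fS' : rdvd f (\sum_(i < n.+1 | i != k) u i 0 * vder Y (p i)).
  by apply: rdvd_sum => j jk; exact/rdvdMl/Yp.
by have := rdvdB fS fS'; rewrite addrK.
Qed.

End HypersurfaceConverse.

(** * The kernel field *)

Section VectorFields.
Variables (K : numFieldType) (n : nat).
Implicit Types (f g h : {mpoly K[n]}) (X Y : 'cV[{mpoly K[n]}]_n).

Definition bracket X Y : 'cV[{mpoly K[n]}]_n :=
  \col_l (vder X (Y l 0) - vder Y (X l 0)).

Lemma vderZ a Y g : vder (a *: Y) g = a * vder Y g.
Proof. by rewrite /vder mulr_sumr; apply: eq_bigr => j _; rewrite mxE mulrA. Qed.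

Lemma vderB X Y g : vder (X - Y) g = vder X g - vder Y g.
Proof. by rewrite /vder -sumrB; apply: eq_bigr => j _; rewrite !mxE mulrBl. Qed.

Lemma vder_bracket X Y g :
  vder (bracket X Y) g = vder X (vder Y g) - vder Y (vder X g).
Proof.
have vv U V : vder U (vder V g) = \sum_l vder U (V l 0) * g^`M(l)
    + \sum_l \sum_j U j 0 * V l 0 * g^`M(l)^`M(j).
  rewrite {2}/vder (big_morph _ (vderD U) (id1 := 0)); last first.
    by rewrite -mpolyC0 vderC.
  rewrite -big_split; apply: eq_bigr => l _; rewrite vderM; congr (_ + _).
  by rewrite {1}/vder mulr_sumr; apply: eq_bigr => j _; ring.
rewrite !vv opprD addrACA -sumrB [X in _ = _ + (_ - X)]exchange_big -sumrB.
rewrite [X in _ = _ + X]big1 ?addr0 => [|l _].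
  by apply: eq_bigr => l _; rewrite mxE mulrBl.
rewrite -sumrB; apply: big1 => j _.
by rewrite mderiv_comm; ring.
Qed.

Lemma rdvd_vder_exp f Y e x :
  rdvd f (vder Y f) -> rdvd (f ^+ e) (vder Y (f ^+ e * x)).
Proof.
move=> [c ec]; rewrite vderM vderXn ec; case: e => [|e] /=.
  by exists (vder Y x); rewrite !expr0; ring.
by exists (e.+1%:R * c * x + vder Y x); rewrite exprS; ring.
Qed.

Lemma natr_unit k : k.+1%:R \is a @GRing.unit {mpoly K[n]}.
Proof.
rewrite -mpolyC_nat; apply: rmorph_unit.
by rewrite unitfE pnatr_eq0.
Qed.

(* If Z kills the p_k modulo f^i, then i X(f) Z - f [X, Z] kills them modulo
   f^(i+1). *)
Lemma tangent_lift f (p : 'I_n -> {mpoly K[n]}) X Y e :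
  prime_elt f -> (0 < e)%N ->
  (forall k, rdvd (f ^+ e) (vder X (p k))) -> ~ rdvd f (vder X f) ->
  (exists l, ~ rdvd f (Y l 0)) -> rdvd f (vder Y f) ->
  (forall k, rdvd f (vder Y (p k))) ->
  exists Y' : 'cV_n, [/\ exists l, ~ rdvd f (Y' l 0), rdvd f (vder Y' f) &
    forall k, rdvd (f ^+ e) (vder Y' (p k))].
Proof.
move=> fp e0 Xp Xf Yn Yf Yp; have [f0 fU fM] := fp.
suff H i : (i < e)%N -> exists Y' : 'cV_n, [/\ exists l, ~ rdvd f (Y' l 0),
    rdvd f (vder Y' f) & forall k, rdvd (f ^+ i.+1) (vder Y' (p k))].
  by rewrite -(prednK e0); apply: H; rewrite prednK.
elim: i => [|i IH] ie; first by exists Y; rewrite expr1.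
have [Z [[l Zl] Zf Zp]] := IH (ltnW ie).
exists ((i.+1%:R * vder X f) *: Z - f *: bracket X Z); split.
(* Modulo f the new field is (i+1) X(f) Z, where i+1 is a unit and X(f) is nonzero. *)
- exists l; rewrite mxE [X in X + _]mxE [X in _ + X]mxE [X in _ - X]mxE => d; apply: Zl.
  have := rdvdD d (rdvdMr (bracket X Z l 0) (rdvd_refl f)).
  rewrite addrNK -mulrA => /(rdvdMU (natr_unit i)) /fM[] //.
- rewrite vderB !vderZ; apply: rdvdB; first exact: rdvdMl.
  exact/rdvdMr/rdvd_refl.
- move=> k; rewrite vderB !vderZ vder_bracket.
  (* With Z(p_k) = R f^(i+1), the term (i+1) f^(i+1) X(f) R in f X(Z(p_k)) cancels the first
     summand. The term Z(X(p_k)) keeps its factor f^e because Z is tangent to f = 0. *)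
  have [R eR] := Zp k; have [S eS] := Xp k.
  have [T eT] := rdvd_vder_exp e S Zf.
  have [d ed] : exists d, f ^+ e = d * f ^+ i.+1.
    by exists (f ^+ (e - i.+1)); rewrite -exprD subnK // ltnW.
  rewrite eS eR [S * _]mulrC eT vderM vderXn ed /=.
  by exists (- vder X R + T * d); rewrite !exprS; ring.
Qed.

End VectorFields.

(** Each division by [f] lowers the degree of [F i0]. The index type is free so that the result
    serves all entries of a matrix as well as a single polynomial, indexed by [unit]. *)
Lemma extract_power (K : numFieldType) n (I : Type) (f : {mpoly K[n]})
    (F : I -> {mpoly K[n]}) (i0 : I) :
  prime_elt f -> F i0 != 0 -> exists (c : nat) (G : I -> {mpoly K[n]}),
    (forall i, F i = f ^+ c * G i) /\ exists i, ~ rdvd f (G i).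
Proof.
move=> fp; have [f0 fU _] := fp.
have sf : (1 < msize f)%N.
  rewrite ltnNge; apply/negP => /msize1_polyC ef; move/negP: fU; apply.
  rewrite ef; apply: rmorph_unit; rewrite unitfE.
  by apply: contraNneq f0 => e; rewrite ef e mpolyC0.
have [N] := ubnP (msize (F i0)); elim: N F => // N IHN F sN F0.
have [ndiv|] := pselect (exists i, ~ rdvd f (F i)).
  by exists 0%N, F; split=> // i; rewrite expr0 mul1r.
move=> ndiv; have /choice[G eG] i : exists c, F i = c * f.
  by apply: contrapT => h; apply: ndiv; exists i.
have G0 : G i0 != 0 by apply: contraNneq F0 => h; rewrite eG h mul0r.
have [|c [H [eH nH]]] := IHN G _ G0.
  apply: leq_trans (_ : (msize (G i0)).+1 <= _)%N => //.
  move: sN; rewrite eG msizeM //; move: sf; clear.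
  by move: (msize f) (msize (G i0)); lia.
by exists c.+1, H; split=> // i; rewrite eG eH exprS; ring.
Qed.

(* B is the adjugate of the tangent map divided by the largest possible power
   of f. *)
Lemma tangent_direction (K : numFieldType) n (f : {mpoly K[n.+1]})
    (p : 'I_n.+1 -> {mpoly K[n.+1]}) :
  prime_elt f -> \det (tangent_mx p) != 0 -> rdvd f (\det (tangent_mx p)) ->
  ~ tangent_rank p f ->
  exists (B : 'M_n.+1) (W : 'cV_n.+1) (h : {mpoly K[n.+1]}),
    [/\ tangent_mx p *m B = h%:M, rdvd h (\det (tangent_mx p)),
        exists i, ~ rdvd f ((B *m W) i 0) & rdvd f (vder (B *m W) f)].
Proof.
move=> fp J0 fJ nR; have [f0 fU fM] := fp.
set M := tangent_mx p in J0 fJ *.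
have [[i0 j0] A0] : exists ij : 'I_n.+1 * 'I_n.+1, (\adj M) ij.1 ij.2 != 0.
  apply: contrapT => nA; move/eqP: J0; apply.
  have A00 : \adj M = 0.
    apply/matrixP => i j; rewrite [RHS]mxE; apply: contrapT => h.
    by apply: nA; exists (i, j); apply/eqP.
  by have /matrixP/(_ ord0 ord0) := mul_mx_adj M; rewrite A00 mulmx0 !mxE.
have [c [G [eG [[i1 j1] /= nG]]]] :=
  extract_power (F := fun ij => (\adj M) ij.1 ij.2) (i0 := (i0, j0)) fp A0.
have [m [G' [eG' [[] nG']]]] :=
  extract_power (F := fun _ : unit => \det M) (i0 := tt) fp J0.
pose B : 'M_n.+1 := \matrix_(i, j) G (i, j).
have adjE : \adj M = f ^+ c *: B.
  by apply/matrixP => i j; rewrite !mxE -[RHS]eG mxE.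
set J' := G' tt in nG'; have JE : \det M = f ^+ m * J' := eG' tt.
have fX k : f ^+ k != 0 by rewrite expf_neq0.
have scI k (X Y : 'M_n.+1) : f ^+ k *: X = f ^+ k *: Y -> X = Y.
  move=> e; apply/matrixP => i j; apply: (mulfI (fX k)).
  by have /matrixP/(_ i j) := e; rewrite !mxE.
have e1 : f ^+ c *: (M *m B) = (f ^+ m * J')%:M.
  by rewrite scalemxAr -adjE mul_mx_adj JE.
have e2 : f ^+ c *: (B *m M) = (f ^+ m * J')%:M.
  by rewrite scalemxAl -adjE mul_adj_mx JE.
(* If c > m, then f^(c-m) M B would be the scalar matrix J', and f would divide J'. *)
have cm : (c <= m)%N.
  rewrite leqNgt; apply/negP => mc; apply: nG'.
  have /(scI m) : f ^+ m *: (f ^+ (c - m) *: (M *m B)) = f ^+ m *: J'%:M.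
    by rewrite scalerA -exprD subnKC ?(ltnW mc) // e1 scale_scalar_mx.
  move/matrixP/(_ ord0 ord0); rewrite !mxE eqxx mulr1n => <-.
  rewrite -(prednK (_ : 0 < c - m)%N) ?subn_gt0 // exprS -mulrA.
  exact/rdvdMr/rdvd_refl.
pose h := f ^+ (m - c) * J'.
have MB : M *m B = h%:M.
  by apply: (scI c); rewrite e1 scale_scalar_mx mulrA -exprD subnKC.
have BM : B *m M = h%:M.
  by apply: (scI c); rewrite e2 scale_scalar_mx mulrA -exprD subnKC.
have hJ : rdvd h (\det M).
  by exists (f ^+ c); rewrite JE mulrA -exprD subnKC.
(* Otherwise h = J', and f, which divides det M, would divide det M det B = J'^(n+1). *)
have e0 : (0 < m - c)%N.
  rewrite lt0n; apply/eqP => mc0; apply: nG'; apply: (@prime_eltX _ f J' n.+1 fp).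
  have <- : \det M * \det B = J' ^+ n.+1.
    by rewrite -det_mulmx MB det_scalar /h mc0 expr0 mul1r.
  exact: rdvdMr.
have vcol j k : vder (col j B) (p k) = h *+ (k == j).
  by rewrite -tangent_mulmx colE mulmxA MB mul_scalar_mx !mxE eqxx andbT mulr_natr.
have [tang|ntang] := pselect (forall j, rdvd f (vder (col j B) f)).
  exists B, (delta_mx j1 0), h; rewrite -colE; split=> //.
  by exists i1; rewrite !mxE.
have [j Xf] : exists j, ~ rdvd f (vder (col j B) f).
  by apply: contrapT => nj; apply: ntang => j; apply: contrapT => d; apply: nj; exists j.
have [Y0 [Yn Yp Yf]] := tangent_kernel fp fJ nR.
have Xp k : rdvd (f ^+ (m - c)) (vder (col j B) (p k)).
  by rewrite vcol -mulr_natr -mulrA; exact/rdvdMr/rdvd_refl.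
have [Y [[l Yl] Yf' Yp']] := tangent_lift fp e0 Xp Xf Yn Yf Yp.
have [R eR] := choice Yp'.
pose W : 'cV_n.+1 := \col_k R k.
have MY : M *m Y = f ^+ (m - c) *: W.
  by apply/colP => k; rewrite tangent_mulmx eR !mxE mulrC.
have BW : B *m W = J' *: Y.
  apply/colP => i; apply: (mulfI (fX (m - c)%N)).
  have : (B *m M *m Y) i 0 = h * Y i 0 by rewrite BM mul_scalar_mx mxE.
  by rewrite -mulmxA MY -scalemxAr !mxE mulrA => <-.
exists B, W, h; rewrite BW; split=> //; last by rewrite vderZ; exact: rdvdMl.
by exists l; rewrite mxE => /fM[].
Qed.

Lemma dvdp_root (K : fieldType) (p q : {poly K}) z :
  p %| q -> p.[z] = 0 -> q.[z] = 0.
Proof. by case/dvdpP => c -> pz; rewrite hornerM pz mulr0. Qed.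

(** * Smith forms and the roots of delta *)

Section SmithForm.
Variables (K : numClosedFieldType) (n : nat).
Variables (Mz P Q : 'M[{poly K}]_n.+1) (s : 'rV[{poly K}]_n.+1).
Hypothesis smith : smith_form Mz P Q s.
Implicit Types z : K.

Local Notation at_ z := (map_mx (horner_eval z)).
Local Notation N := (@ord_max n).

Lemma smith_dvdp (i j : 'I_n.+1) : (i <= j)%N -> s 0 i %| s 0 j.
Proof.
case: smith => _ _ _ ss; case: j => j jn; elim: j jn => [|j IH] jn ij.
  by rewrite (_ : i = Ordinal jn) //; apply/val_inj/eqP; rewrite -leqn0.
move: ij; rewrite leq_eqVlt => /predU1P[ij|ij].
  by rewrite (_ : i = Ordinal jn) //; apply/val_inj.
have jn' : (j < n.+1)%N by rewrite ltnW.
by apply: dvdp_trans (IH jn' _) (ss (Ordinal jn') (Ordinal jn) erefl).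
Qed.

Lemma smith_dvdp_last j : s 0 j %| smith_last s.
Proof. by apply: smith_dvdp; rewrite -ltnS ltn_ord. Qed.

Lemma smith_dvdp_prev j : j != N -> s 0 j %| smith_prev s.
Proof.
move=> jN; have jn : (j < n)%N.
  rewrite ltn_neqAle -ltnS ltn_ord andbT.
  by apply: contra jN => /eqP e; apply/eqP/val_inj.
rewrite /smith_prev; case: eqP => [n0|_]; first by exfalso; lia.
by apply: smith_dvdp; rewrite inordK; [lia|rewrite ltnS leq_pred].
Qed.

Lemma smith_det : \det P * \det Mz * \det Q = \prod_j s 0 j.
Proof. by case: smith => _ _ e _; rewrite -!det_mulmx e det_diag. Qed.

Lemma unit_horner (u : {poly K}) z : u \is a GRing.unit -> u.[z] != 0.
Proof.
rewrite poly_unitE => /andP[/eqP su u0].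
by rewrite (size1_polyC (eq_leq su)) hornerC -unitfE.
Qed.

Lemma unitmx_at (A : 'M[{poly K}]_n.+1) z : A \in unitmx -> at_ z A \in unitmx.
Proof.
rewrite !unitmxE => uA; rewrite unitfE det_map_mx /=.
exact: unit_horner.
Qed.

(** Up to units the determinant is the product of the s_j, and all of them divide the last one. *)
Lemma smith_root z : (\det Mz).[z] = 0 <-> (smith_last s).[z] = 0.
Proof.
case: smith => uP uQ _ _; have := congr1 (horner_eval z) smith_det.
rewrite !rmorphM rmorph_prod /= /horner_eval => e; split=> h.
  move: e; rewrite h mulr0 mul0r => /esym/eqP; rewrite prodf_seq_eq0.
  case/hasP => j _ /= /eqP sj.
  exact: dvdp_root (smith_dvdp_last j) sj.
move: e; rewrite (bigD1 N) //= -/(smith_last s) h mul0r => /eqP.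
have := unit_horner z uP; have := unit_horner z uQ => uQz uPz.
by rewrite !mulf_eq0 (negbTE uPz) (negbTE uQz) orbF => /eqP.
Qed.

Lemma smith_kernel z j : (s 0 j).[z] = 0 -> at_ z Mz *m col j (at_ z Q) = 0.
Proof.
move=> sj; case: smith => uP uQ e _.
have : at_ z P *m (at_ z Mz *m col j (at_ z Q)) = 0.
  rewrite colE !mulmxA -!map_mxM e -colE; apply/colP => i; rewrite !mxE.
  by case: eqP => [->|_]; rewrite /= /horner_eval ?mulr1n ?sj // mulr0n horner0.
move/(congr1 (mulmx (invmx (at_ z P)))).
by rewrite mulKmx ?unitmx_at // mulmx0.
Qed.

Hypothesis s0 : smith_last s != 0.

Lemma delta1K : delta1 s * gcdp (smith_prev s ^+ n.+1) (smith_last s) = smith_last s.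
Proof. by rewrite /delta1 divpK // dvdp_gcdr. Qed.

Lemma delta1_neq0 : delta1 s != 0.
Proof. by apply: contraNneq s0 => h; rewrite -delta1K h mul0r. Qed.

Lemma deltaK : delta s * gcdp (delta1 s) (delta1 s)^`() = delta1 s.
Proof. by rewrite /delta divpK // dvdp_gcdl. Qed.

Lemma delta_neq0 : delta s != 0.
Proof. by apply: contraNneq delta1_neq0 => h; rewrite -deltaK h mul0r. Qed.

Lemma delta_root_last z : root (delta s) z -> (smith_last s).[z] = 0.
Proof. by move/rootP => h; rewrite -delta1K -deltaK !hornerM h !mul0r. Qed.

(** Take k to be the order of s_N at [z]. If (X - z)^k divided s_(N-1), it would divide the gcd in
    [delta1]; the root of [delta1] at [z] would then raise the order of s_N to k + 1. *)
Lemma delta_root_order z : root (delta s) z -> exists k,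
  ('X - z%:P) ^+ k %| smith_last s /\ ~~ (('X - z%:P) ^+ k %| smith_prev s).
Proof.
move=> dz; have [k [q]] := multiplicity_XsubC (smith_last s) z.
rewrite s0 => /= qz e; exists k; split; first by rewrite e dvdp_mull.
apply/negP => kp; have : ('X - z%:P) ^+ k.+1 %| smith_last s.
  rewrite -delta1K exprS dvdp_mul //.
    by rewrite dvdp_XsubCl -deltaK rootM dz.
  by rewrite dvdp_gcd exprS dvdp_mulr //= e dvdp_mull.
rewrite e exprS dvdp_mul2r ?expf_neq0 ?polyXsubC_eq0 //.
by rewrite dvdp_XsubCl (negbTE qz).
Qed.

Lemma delta_root z :
  (smith_last s).[z] = 0 -> (smith_prev s).[z] != 0 -> root (delta s) z.
Proof.
move=> sz pz.
have gz : (gcdp (smith_prev s ^+ n.+1) (smith_last s)).[z] != 0.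
  apply: contraNneq pz => gz.
  have := dvdp_root (dvdp_gcdl (smith_prev s ^+ n.+1) (smith_last s)) gz.
  by rewrite horner_exp => /eqP; rewrite expf_eq0.
have d1z : root (delta1 s) z.
  by move: sz; rewrite -delta1K hornerM => /eqP; rewrite mulf_eq0 (negbTE gz) orbF.
have [k [q]] := multiplicity_XsubC (delta1 s) z.
rewrite delta1_neq0 => /= qz e; case: k e => [|k] e.
  by move: d1z; rewrite e expr0 mulr1 (negbTE qz).
(* If delta did not vanish at z, the full power (X - z)^(k+1) in [delta1] would divide its
   derivative, whose order at z is only k in characteristic zero. *)
apply: contraT => dz.
have cop : coprimep (('X - z%:P) ^+ k.+1) (delta s).
  by rewrite coprimep_pexpl // coprimep_sym coprimep_XsubC.
have : ('X - z%:P) ^+ k.+1 %| delta s * gcdp (delta1 s) (delta1 s)^`().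
  by rewrite deltaK e dvdp_mull.
rewrite Gauss_dvdpr // dvdp_gcd => /andP[_].
rewrite e derivM deriv_exp derivXsubC mul1r dvdp_addr; last exact: dvdp_mull.
rewrite /= mulrnAr -mulrnAl exprS dvdp_mul2r ?expf_neq0 ?polyXsubC_eq0 //.
by rewrite dvdp_XsubCl rootE hornerMn mulrn_eq0 -rootE (negbTE qz).
Qed.

(** [delta] is separable, being [delta1] divided by its gcd with its derivative, so over a closed
    field divisibility is a condition on roots. *)
Lemma delta_dvdp (T : {poly K}) :
  delta s %| T <-> forall z, root (delta s) z -> root T z.
Proof.
split=> [d z /rootP dz|dT]; first exact/rootP/(dvdp_root d dz).
have [r e] := closed_field_poly_normal (delta s).
have sep : separable_poly (delta s) by exact: (make_separable delta1_neq0).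
have l0 : lead_coef (delta s) != 0 by rewrite lead_coef_eq0 delta_neq0.
rewrite e dvdpZl //; apply: uniq_roots_dvdp.
  apply/allP => z zr; apply: dT.
  by rewrite e rootZ // root_prod_XsubC.
rewrite uniq_rootsE -separable_prod_XsubC.
by rewrite -(eqp_separable (eqp_scale _ l0)) -e.
Qed.

(* Writing B = Q C, all the rows of C but the last one vanish at z. *)
Lemma smith_last_column (B : 'M[{poly K}]_n.+1) (h : {poly K}) z (w : 'cV[K]_n.+1) k :
  Mz *m B = h%:M -> ('X - z%:P) ^+ k %| smith_last s ->
  ~~ (('X - z%:P) ^+ k %| smith_prev s) ->
  exists t, at_ z B *m w = t *: col N (at_ z Q).
Proof.
move=> MB kN kprev; case: smith => uP uQ e _.
pose C := invmx Q *m B; have BE : B = Q *m C by rewrite mulKVmx.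
have sC i j : s 0 i * C i j = h * P i j.
  have /matrixP/(_ i j) : diag_mx s *m C = h *: P.
    by rewrite -e -!mulmxA mulKVmx // MB mul_mx_scalar.
  by rewrite mul_diag_mx !mxE.
(* The last row of P(z) is nonzero, so (X - z)^k, which divides s_N C_Nl = h P_Nl, divides h. For i
   different from N it then divides s_i C_ij but not s_i, which forces C_ij(z) = 0. *)
have [l Pl] : exists l, (P N l).[z] != 0.
  apply: contrapT => nl; have := unitmx_at z uP.
  move/mulmxK => PK; have := PK _ (delta_mx 0 N : 'rV_n.+1).
  rewrite -rowE (_ : row N _ = 0) ?mul0mx.
    by move/rowP/(_ N)/eqP; rewrite !mxE !eqxx eq_sym oner_eq0.
  apply/rowP => l; rewrite !mxE; apply: contrapT => /eqP hl.
  by apply: nl; exists l.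
have kh : ('X - z%:P) ^+ k %| h.
  have : ('X - z%:P) ^+ k %| h * P N l by rewrite -sC dvdp_mulr.
  by rewrite Gauss_dvdpl // coprimep_expl // coprimep_sym coprimep_XsubC rootE.
have C0 i j : i != N -> (C i j).[z] = 0.
  move=> iN; apply: contrapT => /eqP Cz.
  move/negP: kprev; apply; apply: dvdp_trans (smith_dvdp_prev iN).
  have : ('X - z%:P) ^+ k %| s 0 i * C i j by rewrite sC dvdp_mulr.
  by rewrite Gauss_dvdpl // coprimep_expl // coprimep_sym coprimep_XsubC rootE.
exists ((at_ z C *m w) N 0); rewrite BE map_mxM -mulmxA.
apply/colP => i; rewrite mxE (bigD1 N) //= big1 ?addr0 => [|j jN].
  by rewrite !mxE mulrC.
rewrite [X in _ * X]mxE big1 ?mulr0 // => l' _.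
by rewrite mxE /= /horner_eval C0 // mul0r.
Qed.

End SmithForm.

(** * The criterion along a good line *)

Section LineCriterion.
Variables (K : numClosedFieldType) (n : nat).
Implicit Types (f g : {mpoly K[n.+1]}) (a b x v : 'I_n.+1 -> K).

(** The substitution of [line_pullback] on coordinate vectors, bundled as a ring morphism so that it
    commutes with determinants and matrix products. *)
Definition pullback a b : {rmorphism {mpoly K[n.+1]} -> {poly K}} :=
  mmap (@polyC K) (fun j => a j *: 'X + (b j)%:P).

Lemma pullbackE a b g z : (pullback a b g).[z] = g.@[line_at a b z].
Proof.
apply: (mpoly_rmorph_ext (phi := horner_eval z \o pullback a b)
  (psi := meval (line_at a b z))) => [c|j].
  have e : pullback a b c%:MP = c%:P by rewrite [LHS]mmapC.
  by rewrite [RHS]mevalC /= e /horner_eval hornerC.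
have e : pullback a b 'X_j = a j *: 'X + (b j)%:P by rewrite [LHS]mmapX mmap1U.
by rewrite [RHS]mevalXU /= e /horner_eval !hornerE.
Qed.

Definition dir_deriv x v g : K := \sum_i g^`M(i).@[x] * v i.

Lemma dir_derivM x v f g :
  dir_deriv x v (f * g) = dir_deriv x v f * g.@[x] + f.@[x] * dir_deriv x v g.
Proof.
rewrite /dir_deriv mulr_suml mulr_sumr -big_split; apply: eq_bigr => i _ /=.
by rewrite mderivM mevalD !mevalM; ring.
Qed.

(** On f_i = 0 only one Leibniz term survives; where the other factors are nonzero, J_red and f_i
    thus have the same tangent directions. *)
Lemma dir_deriv_prod x v t (f : 'I_t -> {mpoly K[n.+1]}) i : (f i).@[x] = 0 ->
  dir_deriv x v (\prod_j f j) = dir_deriv x v (f i) * \prod_(j | j != i) (f j).@[x].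
Proof.
move=> fx; rewrite (bigD1 i) //= dir_derivM fx mul0r addr0; congr (_ * _).
by rewrite rmorph_prod.
Qed.

Lemma dir_derivZ x v c g : dir_deriv x (fun i => c * v i) g = c * dir_deriv x v g.
Proof. by rewrite /dir_deriv mulr_sumr; apply: eq_bigr => i _; rewrite mulrCA. Qed.

Lemma dir_deriv_vder x (Y : 'cV_n.+1) g :
  dir_deriv x (fun i => (Y i 0).@[x]) g = (vder Y g).@[x].
Proof.
by rewrite /vder rmorph_sum; apply: eq_bigr => i _; rewrite mulrC rmorphM.
Qed.

Variables (p : 'I_n.+1 -> {mpoly K[n.+1]}) (t : nat)
  (f : 'I_t -> {mpoly K[n.+1]}) (m : 'I_t -> nat).
Hypothesis fact : factorization f m (\det (tangent_mx p)).
Local Notation J := (\det (tangent_mx p)).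

Lemma factor_prime i : prime_elt (f i).
Proof. by case: fact => h _ _ _; apply: mpoly_irreducible_prime. Qed.

Lemma factor_neq0 i : f i != 0.
Proof. by case: (factor_prime i). Qed.

Lemma jacobian_neq0 : J != 0.
Proof.
case: fact => _ _ _ [u uU ->]; rewrite mulf_neq0 //.
  by apply: contraTneq uU => ->; rewrite unitr0.
by apply/prodf_neq0 => i _; rewrite expf_neq0 ?factor_neq0.
Qed.

Lemma factor_rdvd i : rdvd (f i) J.
Proof.
case: fact => _ m0 _ [u uU ->]; apply: rdvdMl; rewrite (bigD1 i) //=.
by rewrite -(prednK (m0 i)) exprS -!mulrA; exact/rdvdMr/rdvd_refl.
Qed.

Lemma factor_ndvd i j : j != i -> ~ rdvd (f i) (f j).
Proof.
move=> ji d; have [u uU e] := prime_elt_assoc (factor_prime i) (factor_prime j) d.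
by case: fact => _ _ na _; apply: (na j i ji); exists u.
Qed.

Lemma jacobian_vanish x : J.@[x] = 0 <-> exists i, (f i).@[x] = 0.
Proof.
split=> [|[i fx]]; last by case: (factor_rdvd i) => c ->; rewrite mevalM fx mulr0.
case: fact => _ _ _ [u uU ->]; rewrite mevalM rmorph_prod /= => /eqP.
rewrite mulf_eq0 => /orP[ux|].
  have := rmorph_unit (meval x) uU; rewrite unitfE.
  by rewrite -[_ u]/(u.@[x]) ux.
rewrite prodf_seq_eq0 => /hasP[i _ /=].
by rewrite rmorphXn expf_eq0 => /andP[_ /eqP ?]; exists i.
Qed.

(** The first clause, read at z = 0, makes the pulled back Jacobian nonzero. The next two put a
    point of the line on each f_i, where no other factor vanishes. The fourth preserves there a
    minor witnessing full rank, and the last keeps the tangent combination B W nonzero. *)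
Definition good_line a b : Prop :=
  [/\ J.@[b] != 0, forall i, exists z, (f i).@[line_at a b z] = 0,
    forall i j, j != i -> forall z, (f i).@[line_at a b z] = 0 ->
      (f j).@[line_at a b z] != 0,
    forall i k, let D := \det (tangent_mx (replace p k (f i))) in
      ~ rdvd (f i) D -> forall z, (f i).@[line_at a b z] = 0 ->
      D.@[line_at a b z] != 0 &
    forall i, ~ tangent_rank p (f i) ->
      exists (B : 'M_n.+1) (W : 'cV_n.+1) (h : {mpoly K[n.+1]}),
      [/\ tangent_mx p *m B = h%:M, rdvd (f i) (vder (B *m W) (f i)) &
          exists l, forall z, (f i).@[line_at a b z] = 0 ->
            ((B *m W) l 0).@[line_at a b z] != 0]].

Lemma generic_good_line : generic good_line.
Proof.
have g1 : generic (fun a b : 'I_n.+1 -> K => J.@[b] != 0).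
  exists (px_cst (pairs_ext K n.+1) J); split.
    have [b Jb] := mpoly_neq0_nonroot jacobian_neq0.
    apply: contraNneq Jb => h.
    have <- := @px_homC _ _ _ (pairs_ext K n.+1) _ (meval b) (fun=> 0) J.
    by rewrite h rmorph0.
  by move=> a b; rewrite /pair_eval px_homC.
have g2 : generic (fun a b => forall i, exists z, (f i).@[line_at a b z] = 0).
  by apply: generic_forall => i; exact/generic_root/factor_prime.
have g3 : generic (fun a b => forall i j, j != i -> forall z,
    (f i).@[line_at a b z] = 0 -> (f j).@[line_at a b z] != 0).
  apply: generic_forall => i; apply: generic_forall => j; apply: generic_if => ji.
  exact: generic_no_common_root (factor_prime i) (factor_ndvd ji).
have g4 : generic (fun a b => forall i k,
      let D := \det (tangent_mx (replace p k (f i))) in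
      ~ rdvd (f i) D -> forall z, (f i).@[line_at a b z] = 0 ->
      D.@[line_at a b z] != 0).
  apply: generic_forall => i; apply: generic_forall => k; apply: generic_if => nd.
  exact: generic_no_common_root (factor_prime i) nd.
have g5 : generic (fun a b => forall i, ~ tangent_rank p (f i) ->
      exists (B : 'M_n.+1) (W : 'cV_n.+1) (h : {mpoly K[n.+1]}),
      [/\ tangent_mx p *m B = h%:M, rdvd (f i) (vder (B *m W) (f i)) &
          exists l, forall z, (f i).@[line_at a b z] = 0 ->
            ((B *m W) l 0).@[line_at a b z] != 0]).
  apply: generic_forall => i; apply: generic_if => nR.
  have [B [W [h [MB hJ [l nl] BWf]]]] :=
    tangent_direction (factor_prime i) jacobian_neq0 (factor_rdvd i) nR.
  apply: generic_impl (generic_no_common_root (factor_prime i) nl) => a b hz.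
  by exists B, W, h; split=> //; exists l.
apply: generic_impl
  (generic_and g1 (generic_and g2 (generic_and g3 (generic_and g4 g5)))).
by move=> a b [? [? [? [? ?]]]].
Qed.

Lemma line_criterion a b (P Q : 'M[{poly K}]_n.+1) (s : 'rV[{poly K}]_n.+1) :
  good_line a b -> smith_form (map_mx (pullback a b) (tangent_mx p)) P Q s ->
  ((forall i, ~ tangent_rank p (f i)) <->
   delta s %| \sum_i pullback a b (\prod_(j < t) f j)^`M(i) * Q i ord_max).
Proof.
move=> [Jb fz fij frank fdir] smith.
set Mz := map_mx _ _ in smith; set T := \sum_i _.
pose q z i := (Q i ord_max).[z].
have TE z : T.[z] = dir_deriv (line_at a b z) (q z) (\prod_j f j).
  by rewrite horner_sum; apply: eq_bigr => i _; rewrite hornerM pullbackE.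
have detE z : (\det Mz).[z] = J.@[line_at a b z].
  by rewrite -pullbackE -det_map_mx.
have MzE z : map_mx (horner_eval z) Mz = map_mx (meval (line_at a b z)) (tangent_mx p).
  by apply/matrixP => i j; rewrite !mxE /= /horner_eval pullbackE.
have s0 : smith_last s != 0.
  apply/eqP => s0; have := smith_root smith 0; rewrite s0 horner0 detE => -[_ /(_ erefl)].
  rewrite (meval_eq (v2 := b)) => [/eqP|j]; first by rewrite (negbTE Jb).
  by rewrite /line_at mulr0 add0r.
have q0 z : exists i, q z i != 0.
  apply: contrapT => nq; case: smith => _ uQ _ _.
  have := mulKmx (unitmx_at z uQ) (delta_mx ord_max 0 : 'cV_n.+1).
  rewrite -colE (_ : col _ _ = 0) ?mulmx0.
    by move/colP/(_ ord_max)/eqP; rewrite !mxE !eqxx eq_sym oner_eq0.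
  apply/colP => i; rewrite !mxE; apply: contrapT => /eqP h.
  by apply: nq; exists i.
split=> [nR|dT i [k fk]].
  apply/(delta_dvdp s0) => z dz; apply/rootP; rewrite TE.
  have : J.@[line_at a b z] = 0.
    by rewrite -detE; apply/(smith_root smith); exact: delta_root_last.
  case/jacobian_vanish => i fx; rewrite (dir_deriv_prod _ fx).
  have [k [ks kp]] := delta_root_order s0 dz.
  have [B [W [h [MB BWf [l /(_ z fx) BWl]]]]] := fdir i (nR i).
  have MzB : Mz *m map_mx (pullback a b) B = (pullback a b h)%:M.
    by rewrite -map_mxM MB map_scalar_mx.
  have [c cE] := smith_last_column smith (map_mx (meval (line_at a b z)) W) MzB ks kp.
  have BWE j : ((B *m W) j 0).@[line_at a b z] = c * q z j.
    move/colP/(_ j): cE; rewrite [RHS]mxE [X in _ = _ * X]mxE [X in _ = _ * X]mxE => <-.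
    rewrite !mxE rmorph_sum; apply: eq_bigr => j' _.
    by rewrite rmorphM !mxE /= /horner_eval pullbackE.
  have c0 : c != 0 by apply: contraNneq BWl => c0; rewrite BWE c0 mul0r.
  suff -> : dir_deriv (line_at a b z) (q z) (f i) = 0 by rewrite mul0r.
  apply: (mulfI c0); rewrite mulr0 -dir_derivZ.
  have [d ed] := BWf; have := dir_deriv_vder (line_at a b z) (B *m W) (f i).
  rewrite ed mevalM fx mulr0 => <-; apply: eq_bigr => j _.
  by rewrite BWE.
have [z fx] := fz i; set x := line_at a b z in fx.
have Dx := frank i k fk z fx.
(* The matrix M(x) with row k replaced by df_i is invertible, so M(x) and df_i have no common
   nonzero kernel vector. *)
have ker v : (forall j, dir_deriv x v (p j) = 0) -> dir_deriv x v (f i) = 0 ->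
    forall j, v j = 0.
  move=> pv fv; pose D := map_mx (meval x) (tangent_mx (replace p k (f i))).
  have uD : D \in unitmx by rewrite unitmxE unitfE det_map_mx.
  suff /(congr1 (mulmx (invmx D))) : D *m (\col_j v j) = 0.
    by rewrite mulKmx // mulmx0 => /colP e j; have := e j; rewrite !mxE.
  apply/colP => j; rewrite !mxE; transitivity (dir_deriv x v (replace p k (f i) j)).
    by apply: eq_bigr => l _; rewrite !mxE.
  by rewrite /replace; case: eqP.
have kerS j : (s 0 j).[z] = 0 -> forall l, dir_deriv x (fun i => (Q i j).[z]) (p l) = 0.
  move=> sj l; have := smith_kernel smith sj; rewrite MzE => /colP/(_ l).
  rewrite !mxE => e; rewrite -[RHS]e; apply: eq_bigr => i' _.
  by rewrite !mxE.
have sN : (smith_last s).[z] = 0.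
  by apply/(smith_root smith); rewrite detE; apply/jacobian_vanish; exists i.
have fq : dir_deriv x (q z) (f i) <> 0.
  by move=> fq; have [j] := q0 z; rewrite (ker (q z)) ?eqxx //; exact: kerS.
(* If s_(N-1) vanished at z, two independent columns of Q(z) would lie in the kernel of M(x), and
   their combination [v] killed by df_i would be zero, although its coefficient [al] is nonzero. *)
have sp : (smith_prev s).[z] != 0.
  rewrite /smith_prev; case: (n =P 0%N) => [_|n0]; first by rewrite hornerE oner_eq0.
  set j := inord n.-1; apply/eqP => sj.
  have jN : j != ord_max.
    by apply/eqP => /(congr1 val) /=; rewrite inordK ?ltnS ?leq_pred //; lia.
  pose al := dir_deriv x (q z) (f i); pose be := dir_deriv x (fun i => (Q i j).[z]) (f i).
  pose v l := al * (Q l j).[z] - be * q z l.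
  have dv g : dir_deriv x v g =
      al * dir_deriv x (fun i => (Q i j).[z]) g - be * dir_deriv x (q z) g.
    by rewrite /dir_deriv !mulr_sumr -sumrB; apply: eq_bigr => l _; rewrite /v; ring.
  have v0 : forall l, v l = 0.
    apply: ker => [l|]; first by rewrite dv !kerS //; ring.
    by rewrite dv -/al -/be; ring.
  case: smith => _ uQ _ _.
  have := mulKmx (unitmx_at z uQ)
    (al *: delta_mx j 0 - be *: delta_mx ord_max 0 : 'cV_n.+1).
  rewrite mulmxBr -!scalemxAr -!colE (_ : _ - _ = 0).
    rewrite mulmx0 => /colP/(_ j)/eqP; rewrite !mxE eqxx (negbTE jN) mulr1 mulr0 subr0.
    by rewrite eq_sym => /eqP.
  by apply/colP => l; rewrite !mxE; exact: v0.
have := dvdp_root dT (rootP (delta_root s0 sN sp)).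
rewrite TE (dir_deriv_prod _ fx) => /eqP; rewrite mulf_eq0 => /orP[/eqP//|].
rewrite prodf_seq_eq0 => /hasP[j _ /= /andP[ji]].
by rewrite (negbTE (fij i j ji z fx)).
Qed.

End LineCriterion.

(** * Contraction of the ramification divisor *)

Section Zariski.
Variables (K : numClosedFieldType) (n : nat) (V : vectType K) (v : n.+1.-tuple V).
Hypothesis vb : basis_of fullv v.
Implicit Types (q g h : {mpoly K[n.+1]}) (y : V).

Local Notation cr y := (fun i : 'I_n.+1 => coord v i y).

Lemma coord_surj (c : 'I_n.+1 -> K) : exists y, forall i, coord v i y = c i.
Proof.
exists (\sum_i c i *: v`_i) => i.
by rewrite (coord_sum_free _ _ (basis_free vb)).
Qed.

Lemma coord_sum y : y = \sum_i coord v i y *: v`_i.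
Proof. by apply: coord_basis vb _; rewrite memvf. Qed.

Lemma regularP (F : V -> K) : regular F <-> exists q, forall y, F y = q.@[cr y].
Proof.
split=> [[k [l [q e]]]|[q e]]; last first.
  by exists n.+1, (fun i => coord v i : {scalar V}), q.
exists (subst (fun i => \sum_(j < n.+1) (l i v`_j) *: 'X_j) q) => y; rewrite e.
apply: (mpoly_rmorph_ext (phi := meval (fun i => l i y))
  (psi := meval (cr y) \o subst (fun i => \sum_(j < n.+1) (l i v`_j) *: 'X_j))) => [c|i].
  by rewrite [LHS]mevalC /= [subst _ _]mmapC mevalC.
rewrite [LHS]mevalXU /= [subst _ _]mmapX mmap1U rmorph_sum /=.
rewrite {1}[y]coord_sum linear_sum; apply: eq_bigr => j _.
by rewrite linearZ mevalZ mevalXU mulrC.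
Qed.

Lemma zclosed_vanishing (F : set {mpoly K[n.+1]}) :
  zclosed [set y | forall q, F q -> q.@[cr y] = 0].
Proof.
exists [set G | exists2 q, F q & forall y, G y = q.@[cr y]]; split.
  by move=> G [q _ e]; apply/regularP; exists q.
apply/seteqP; split=> y /= h.
  by move=> G [q Fq ->]; exact: h.
by move=> q Fq; apply: (h (fun y => q.@[cr y])); exists q.
Qed.

Lemma zclosedP (Z : set V) : zclosed Z ->
  exists F : set {mpoly K[n.+1]}, Z = [set y | forall q, F q -> q.@[cr y] = 0].
Proof.
move=> [F [Freg ->]].
exists [set q | exists2 G, F G & forall y, G y = q.@[cr y]].
apply/seteqP; split=> y /= h.
  by move=> q [G FG <-]; exact: h.
move=> G FG; have /regularP[q e] := Freg G FG.
by rewrite e; apply: h; exists G.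
Qed.

Lemma zclosureP (A : set V) y : zclosure A y <->
  forall q, (forall x, A x -> q.@[cr x] = 0) -> q.@[cr y] = 0.
Proof.
split=> [Ay q qA|h Z [/zclosedP[F ->] /= AZ] q Fq]; last first.
  by apply: h => x /AZ; exact.
have := Ay [set y | forall q', q' = q -> q'.@[cr y] = 0]; apply=> //.
by split=> [|x Ax _ ->]; [exact: (zclosed_vanishing [set q])|exact: qA].
Qed.

Lemma zero_locus_closed q : zclosed (zero_locus v q).
Proof.
have := zclosed_vanishing [set q]; congr zclosed.
by apply/seteqP; split=> y /= h; [exact: h|move=> _ ->].
Qed.

Lemma zero_locus_vanishing g h : prime_elt h ->
  (forall y, h.@[cr y] = 0 -> g.@[cr y] = 0) -> rdvd h g.
Proof.
move=> hp hg; apply: prime_vanishing => // c hc.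
have [y yc] := coord_surj c.
by rewrite -(meval_eq _ yc); apply: hg; rewrite (meval_eq _ yc).
Qed.

Lemma zero_locus_irreducible h : prime_elt h -> irreducible_zclosed (zero_locus v h).
Proof.
move=> hp; have [h0 hU hM] := hp; split; first exact: zero_locus_closed.
  apply: contrapT => ne; have /(prime_eltU hp) : rdvd h 1.
    by apply: zero_locus_vanishing => // y hy; exfalso; apply: ne; exists y.
  by rewrite unitr1.
move=> A B /zclosedP[FA ->] /zclosedP[FB ->] hAB; apply: contrapT => /not_orP[nA nB].
have sep F : ~ (zero_locus v h `<=` [set y | forall q, F q -> q.@[cr y] = 0]) ->
    exists2 q, F q & ~ rdvd h q.
  move=> nF; apply: contrapT => nq; apply: nF => y hy q Fq.
  have [c ->] : rdvd h q by apply: contrapT => nd; apply: nq; exists q.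
  by rewrite mevalM (_ : h.@[_] = 0) ?mulr0.
have [qA FqA nqA] := sep FA nA; have [qB FqB nqB] := sep FB nB.
have /hM[//|//] : rdvd h (qA * qB).
apply: zero_locus_vanishing => // y hy; rewrite mevalM.
by have [/(_ qA FqA)->|/(_ qB FqB)->] := hAB y hy; rewrite ?mul0r ?mulr0.
Qed.

Lemma exists_nonroot q : q != 0 -> exists y, q.@[cr y] != 0.
Proof.
move=> /mpoly_neq0_nonroot[c qc]; have [y yc] := coord_surj c.
by exists y; rewrite (meval_eq _ yc).
Qed.

Lemma setT_irreducible : irreducible_zclosed (setT : set V).
Proof.
split.
- have := zclosed_vanishing set0; congr zclosed.
  by apply/seteqP; split=> // y _ q [].
- by exists 0.
move=> A B /zclosedP[FA ->] /zclosedP[FB ->] hAB; apply: contrapT => /not_orP[nA nB].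
have sep F : ~ (setT `<=` [set y | forall q, F q -> q.@[cr y] = 0]) ->
    exists2 q, F q & q != 0.
  move=> nF; apply: contrapT => nq; apply: nF => y _ q Fq.
  have [->|q0] := eqVneq q 0; first by rewrite meval0.
  by exfalso; apply: nq; exists q.
have [qA FqA nqA] := sep FA nA; have [qB FqB nqB] := sep FB nB.
have [y] : exists y, (qA * qB).@[cr y] != 0 by apply: exists_nonroot; rewrite mulf_neq0.
rewrite mevalM.
by have [/(_ qA FqA)->|/(_ qB FqB)->] := hAB y I; rewrite ?mul0r ?mulr0 eqxx.
Qed.

(** A nonzero q vanishing on [c] is h^k G with G not divisible by [h]. By irreducibility [c] lies in
    h = 0, against strictness, or in G = 0, which would force [h] to divide G. *)
Lemma hypersurface_maximal h (c : set V) : prime_elt h -> irreducible_zclosed c ->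
  zero_locus v h `<` c -> ~ (c `<` setT).
Proof.
move=> hp [/zclosedP[F cE] _ cirr] [hc nch] [_ ncT].
have [q Fq q0] : exists2 q, F q & q != 0.
  apply: contrapT => nq; apply: ncT => y _; rewrite cE => q Fq.
  have [->|q0] := eqVneq q 0; first by rewrite meval0.
  by exfalso; apply: nq; exists q.
have [k [G [eG [[] nG]]]] := extract_power (F := fun _ : unit => q) (i0 := tt) hp q0.
have [|||/nch//|cG] := cirr (zero_locus v h) (zero_locus v (G tt)).
- exact: zero_locus_closed.
- exact: zero_locus_closed.
- move=> y; rewrite cE => /(_ q Fq); rewrite (eG tt) mevalM rmorphXn => /eqP.
  rewrite mulf_eq0 => /orP[|/eqP ?]; last by right.
  by rewrite expf_eq0 => /andP[_ /eqP ?]; left.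
by apply: nG; apply: zero_locus_vanishing => // y hy; apply: cG; exact: hc.
Qed.

Lemma codim_ge2_no_hypersurface (Z : set V) h :
  codim_ge 2 Z -> prime_elt h -> ~ (zero_locus v h `<=` Z).
Proof.
move=> cZ hp hZ; have [c [c0 cirr cinc]] := cZ _ (zero_locus_irreducible hp) hZ.
apply: (hypersurface_maximal (c := c 1%N) hp).
- exact: cirr.
- by rewrite -c0; exact: cinc.
- have [_ n21] := cinc 1%N isT; split=> // T1; apply: n21 => y _; exact: T1.
Qed.

(** The ideal of an irreducible Y in [Z] is prime and contains [g], hence some prime h; the chain is
    Y, {h = 0}, V, its first inclusion being strict by the last hypothesis. *)
Lemma codim_ge2_intro (Z : set V) g : g != 0 -> (forall y, Z y -> g.@[cr y] = 0) ->
  (forall h, prime_elt h -> ~ (zero_locus v h `<=` Z)) -> codim_ge 2 Z.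
Proof.
move=> g0 gZ nh Y Yirr YZ; have [_ [y0 Yy0] Yor] := Yirr.
have [|||h hp hY] := @exists_prime_in K n.+1 (fun q => forall y, Y y -> q.@[cr y] = 0).
- by exists g => // y /YZ; exact: gZ.
- by move=> c /(_ y0 Yy0); rewrite mevalC.
- move=> q q' qq'; apply: (Yor (zero_locus v q) (zero_locus v q')).
  + exact: zero_locus_closed.
  + exact: zero_locus_closed.
  + move=> y /qq'; rewrite mevalM => /eqP; rewrite mulf_eq0.
    by case/orP => /eqP; [left|right].
have [h0 _ _] := hp.
exists (fun i => match i with 0 => Y | 1 => zero_locus v h | _ => setT end); split=> //.
  move=> [|[|i]] _ //; first exact: zero_locus_irreducible.
  exact: setT_irreducible.
move=> [|[|//]] _; split=> //.
  by move=> hYs; apply: (nh h hp) => y /hYs; exact: YZ.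
by move=> Th; have [y] := exists_nonroot h0; rewrite (Th y I) eqxx.
Qed.

End Zariski.

(** * The rank condition and the closure of the image *)

Section Contraction.
Variables (K : numClosedFieldType) (n : nat) (E V : vectType K).
Variables (e : n.+1.-tuple E) (v : n.+1.-tuple V) (pi : E -> V).
Variable p : 'I_n.+1 -> {mpoly K[n.+1]}.
Hypotheses (eb : basis_of fullv e) (vb : basis_of fullv v).
Hypothesis comp : components e v pi p.
Variables (t : nat) (f : 'I_t -> {mpoly K[n.+1]}) (m : 'I_t -> nat).
Hypothesis fact : factorization f m (\det (tangent_mx p)).
Local Notation J := (\det (tangent_mx p)).

Lemma subst_components q x :
  (subst p q).@[fun j => coord e j x] = q.@[fun i => coord v i (pi x)].
Proof.
apply: (mpoly_rmorph_ext (phi := meval (fun j => coord e j x) \o subst p)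
  (psi := meval (fun i => coord v i (pi x)))) => [c|i].
  by rewrite [RHS]mevalC /= [subst _ _]mmapC mevalC.
by rewrite [RHS]mevalXU /= [subst _ _]mmapX mmap1U comp.
Qed.

(** The zero locus of J is the union of the f_i = 0, so the ideal of the image is the intersection
    of the relation ideals modulo the f_i. *)
Lemma image_vanishing q :
  (forall y, (pi @` zero_locus e J) y -> q.@[fun i => coord v i y] = 0) <->
  forall i, rdvd (f i) (subst p q).
Proof.
split=> [h i|h _ [x Jx <-]].
  apply: (zero_locus_vanishing eb); first exact: (factor_prime fact).
  move=> x fx; rewrite subst_components; apply: h; exists x => //.
  by apply/(jacobian_vanish fact); exists i.
have /(jacobian_vanish fact)[i fx] := Jx.
by rewrite -subst_components; case: (h i) => c ->; rewrite mevalM fx mulr0.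
Qed.

(** Full rank at f_i makes the relations modulo f_i multiples of one prime h, and {h = 0} lies in
    the closure. Conversely, a hypersurface {h = 0} in the closure makes (h) contain the
    intersection of the relation ideals, hence one of them. *)
Lemma contractedP : contracted e pi J <-> forall i, ~ tangent_rank p (f i).
Proof.
split=> [cZ i fi|nR].
  have [h [hp fh hI]] := relations_principal (factor_prime fact i) fi.
  apply: (codim_ge2_no_hypersurface vb cZ hp) => y hy.
  apply/(zclosureP vb) => q /image_vanishing/(_ i)/hI[c ->].
  by rewrite mevalM (_ : h.@[_] = 0) ?mulr0.
have /choice[P PE] : forall i, exists P, P != 0 /\ rdvd (f i) (subst p P).
  by move=> i; have [P P0 fP] := relation_mod p (factor_neq0 fact i); exists P.
have fprod (q : 'I_t -> {mpoly K[n.+1]}) : (forall i, rdvd (f i) (subst p (q i))) ->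
    forall i, rdvd (f i) (subst p (\prod_j q j)).
  by move=> fq i; rewrite (bigD1 i) //= rmorphM; exact: rdvdMr.
apply: (codim_ge2_intro vb (g := \prod_i P i)).
- by apply/prodf_neq0 => i _; case: (PE i).
- move=> y /(zclosureP vb); apply; apply/image_vanishing/fprod => i.
  by case: (PE i).
move=> h hp hZ.
(* Otherwise each relation ideal has a member outside (h), and the product of these members lies in
   the intersection but not in the prime ideal (h). *)
have [i hi] : exists i, forall q, rdvd (f i) (subst p q) -> rdvd h q.
  apply: contrapT => ni.
  have /choice[q qE] : forall i, exists q, rdvd (f i) (subst p q) /\ ~ rdvd h q.
    move=> i; apply: contrapT => nq; apply: ni; exists i => q fq.
    by apply: contrapT => nd; apply: nq; exists q.
  have : rdvd h (\prod_i q i).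
    apply: (zero_locus_vanishing vb hp) => y /hZ/(zclosureP vb); apply.
    by apply/image_vanishing/fprod => i; case: (qE i).
  by case/(prime_elt_prod hp) => i _; case: (qE i).
exact: nR i (tangent_rank_of_principal (factor_prime fact i) hp hi).
Qed.

End Contraction.

(** * Independence of the bases *)

Section Radical.
Variable A : idomainType.
Hypothesis irr_prime : forall x : A, irreducible_elt x -> prime_elt x.

Lemma prod_primes_rdvd t (f : 'I_t -> A) (x : A) :
  (forall i, prime_elt (f i)) -> (forall i j, i != j -> ~ associate (f i) (f j)) ->
  (forall i, rdvd (f i) x) -> rdvd (\prod_i f i) x.
Proof.
move=> fp fna fx; rewrite -big_enum /=.
have := enum_uniq 'I_t; elim: (enum 'I_t) => [_|i s IH /=].
  by rewrite big_nil; exists x; rewrite mulr1.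
case/andP => ni us; rewrite big_cons; have [c ec] := IH us.
have [_ _ fM] := fp i; have := fx i; rewrite {1}ec => /fM[[d ed]|].
  by exists d; rewrite ec ed mulrA.
rewrite big_seq => /(prime_elt_prod (fp i))[j js d].
have [u uU eu] := prime_elt_assoc (fp i) (fp j) d.
have ji : j != i by apply: contraNneq ni => <-.
by case: (fna j i ji); exists u.
Qed.

Lemma factorization_rad_rdvd t t' (f : 'I_t -> A) (f' : 'I_t' -> A) m m' x :
  factorization f m x -> factorization f' m' x -> rdvd (\prod_i f i) (\prod_i f' i).
Proof.
move=> [firr m0 fna [u uU ex]] [f'irr _ _ [u' uU' ex']].
have fp i := irr_prime (firr i).
apply: prod_primes_rdvd => // i.
have fx : rdvd (f i) x.
  rewrite ex; apply: rdvdMl; rewrite (bigD1 i) //=.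
  by rewrite -(prednK (m0 i)) exprS -!mulrA; exact/rdvdMr/rdvd_refl.
move: fx; rewrite ex' => /(rdvdMU uU')/(prime_elt_prod (fp i))[j _].
by move/(prime_eltX (fp i)) => d; rewrite (bigD1 j) //=; exact: rdvdMr.
Qed.

(** J_red depends on the chosen factorization only up to a unit. *)
Lemma factorization_rad t t' (f : 'I_t -> A) (f' : 'I_t' -> A) m m' x :
  factorization f m x -> factorization f' m' x ->
  exists2 u, u \is a GRing.unit & \prod_i f' i = u * \prod_i f i.
Proof.
move=> fx f'x; have [c ec] := factorization_rad_rdvd fx f'x.
have [d ed] := factorization_rad_rdvd f'x fx.
exists c => //; have [firr _ _ _] := fx.
have X0 : \prod_i f i != 0 by apply/prodf_neq0 => i _; case: (firr i).
apply/unitrPr; exists d; apply: (mulIf X0).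
by rewrite mul1r {2}ed ec; ring.
Qed.

End Radical.

Lemma factorization_iso (A : idomainType) (phi psi : {rmorphism A -> A}) :
  (forall x : A, irreducible_elt x -> prime_elt x) ->
  cancel phi psi -> cancel psi phi ->
  forall t (f : 'I_t -> A) m x (u : A), u \is a GRing.unit ->
  factorization f m x -> factorization (phi \o f) m (u * phi x).
Proof.
move=> ip phiK psiK t f m x u uU [firr m0 fna [w wU ->]]; split=> //.
- by move=> i; apply/prime_elt_irr/(prime_elt_iso phiK psiK)/ip.
- move=> i j ij [w' wU' e]; apply: (fna i j ij); exists (psi w').
    exact: rmorph_unit.
  by apply: (can_inj phiK); rewrite rmorphM psiK.
- exists (u * phi w); first by rewrite unitrM uU rmorph_unit.
  rewrite rmorphM rmorph_prod mulrA; congr (_ * _).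
  by apply: eq_bigr => i _; rewrite rmorphXn.
Qed.

Section BaseChange.
Variables (K : numClosedFieldType) (n : nat).
Implicit Types g : {mpoly K[n.+1]}.

(** Column j holds the e-coordinates of the j-th vector of e', so the matrix turns e'-coordinates
    into e-coordinates. *)
Definition change_mx (W : vectType K) (e e' : n.+1.-tuple W) : 'M[K]_n.+1 :=
  \matrix_(i, j) coord e i e'`_j.

Lemma change_mxK (W : vectType K) (e e' : n.+1.-tuple W) :
  basis_of fullv e -> basis_of fullv e' -> change_mx e e' *m change_mx e' e = 1%:M.
Proof.
move=> eb e'b; apply/matrixP => i j; rewrite !mxE.
rewrite eq_sym -(coord_free _ _ (basis_free eb)) (coord_sum e'b e`_j) linear_sum.
by apply: eq_bigr => k _; rewrite !mxE linearZ /= mulrC.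
Qed.

Lemma coord_change (W : vectType K) (e e' : n.+1.-tuple W) x i :
  basis_of fullv e' -> coord e i x = \sum_j change_mx e e' i j * coord e' j x.
Proof.
move=> e'b; rewrite {1}(coord_sum e'b x) linear_sum.
by apply: eq_bigr => j _; rewrite linearZ mxE mulrC.
Qed.

Definition linear_subst (B : 'M[K]_n.+1) :
    {rmorphism {mpoly K[n.+1]} -> {mpoly K[n.+1]}} :=
  subst (fun i => \sum_(j < n.+1) B i j *: 'X_j).

Lemma linear_substC B c : linear_subst B c%:MP = c%:MP.
Proof. by rewrite [LHS]mmapC. Qed.

Lemma linear_substU B i : linear_subst B 'X_i = \sum_(j < n.+1) B i j *: 'X_j.
Proof. by rewrite [LHS]mmapX mmap1U. Qed.

Lemma linear_subst_eval B g x :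
  (linear_subst B g).@[x] = g.@[fun i => \sum_j B i j * x j].
Proof.
apply: (mpoly_rmorph_ext (phi := meval x \o linear_subst B)
  (psi := meval (fun i => \sum_j B i j * x j))) => [c|i].
  by rewrite [RHS]mevalC /= linear_substC mevalC.
rewrite [RHS]mevalXU /= linear_substU rmorph_sum.
by apply: eq_bigr => j _; rewrite /= mevalZ mevalXU.
Qed.

Lemma linear_substK B B' : B *m B' = 1%:M -> cancel (linear_subst B) (linear_subst B').
Proof.
move=> BB' g; apply: mpoly_eval_ext => x; rewrite !linear_subst_eval.
apply: meval_eq => i.
have -> : x i = ((B *m B') *m (\col_j x j)) i 0 by rewrite BB' mul1mx mxE.
rewrite -mulmxA mxE; apply: eq_bigr => j _; rewrite mxE; congr (_ * _).
by apply: eq_bigr => k _; rewrite mxE.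
Qed.

Lemma linear_subst_deriv B g l :
  (linear_subst B g)^`M(l) = \sum_j linear_subst B g^`M(j) * (B j l)%:MP.
Proof.
rewrite /linear_subst {1}/subst.
rewrite (@mmap_derivation _ _ _ (@mpolyC n.+1 K) _ (mderiv l)).
- apply: eq_bigr => j _; congr (_ * _).
  rewrite raddf_sum (bigD1 l) //= big1 => [|k kl].
    rewrite mderivZ mderivX mnm1E eqxx scale1r.
    have -> : (U_(l) - U_(l) = 0 :> 'X_{1..n.+1})%MM.
      by apply/mnmP => k; rewrite mnmBE subnn mnm0E.
    by rewrite mpolyX0 addr0 -alg_mpolyC.
  by rewrite mderivZ mderivX mnm1E (negbTE kl) scale0r scaler0.
- exact: mderivD.
- exact: mderivM.
- by move=> c; rewrite mderivC.
Qed.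

End BaseChange.

(** * Transfer of the criterion between bases and factorizations *)

Section Transfer.
Variables (K : numClosedFieldType) (n : nat) (E V : vectType K) (pi : E -> V).
Variables (e e' : n.+1.-tuple E) (v v' : n.+1.-tuple V).
Hypotheses (eb : basis_of fullv e) (eb' : basis_of fullv e').
Hypotheses (vb : basis_of fullv v) (vb' : basis_of fullv v').
Variables p p' : 'I_n.+1 -> {mpoly K[n.+1]}.
Hypotheses (pE : components e v pi p) (pE' : components e' v' pi p').

Local Notation chi := (linear_subst (change_mx e e')).
Local Notation A := (change_mx v' v).
Local Notation B := (change_mx e e').
Local Notation cst := (map_mx (@mpolyC n.+1 K)).

Lemma chi_eval g x : (chi g).@[fun j => coord e' j x] = g.@[fun j => coord e j x].
Proof.
by rewrite linear_subst_eval; apply: meval_eq => i; rewrite -coord_change.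
Qed.

Lemma components_change i : p' i = \sum_k (A i k)%:MP * chi (p k).
Proof.
apply: mpoly_eval_ext => c; have [x xc] := coord_surj eb' c.
rewrite -!(meval_eq _ xc) -pE' (coord_change _ _ _ vb) rmorph_sum.
by apply: eq_bigr => k _; rewrite rmorphM /= mevalC chi_eval -pE.
Qed.

Lemma tangent_change :
  tangent_mx p' = cst A *m map_mx chi (tangent_mx p) *m cst B.
Proof.
apply/matrixP => i l; rewrite [LHS]mxE components_change raddf_sum.
rewrite -mulmxA mxE; apply: eq_bigr => k _.
rewrite /= mderiv_mulC [X in _ = X * _]mxE; congr (_ * _).
rewrite linear_subst_deriv mxE; apply: eq_bigr => j _.
by congr (_ * _); rewrite !mxE.
Qed.

Lemma det_cst_unit (C D : 'M[K]_n.+1) : C *m D = 1%:M ->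
  \det (cst C) \is a GRing.unit.
Proof.
move=> CD; rewrite det_map_mx; apply: rmorph_unit.
rewrite unitfE; apply/eqP => C0; have := congr1 determinant CD.
by rewrite det_mulmx C0 mul0r det1 => /eqP; rewrite eq_sym oner_eq0.
Qed.

Lemma jacobian_change : exists2 u, u \is a GRing.unit &
  \det (tangent_mx p') = u * chi (\det (tangent_mx p)).
Proof.
exists (\det (cst A) * \det (cst B)).
  rewrite unitrM (det_cst_unit (change_mxK vb' vb)).
  by rewrite (det_cst_unit (change_mxK eb eb')).
by rewrite tangent_change !det_mulmx (det_map_mx chi) mulrAC.
Qed.

Lemma contracted_change :
  contracted e pi (\det (tangent_mx p)) <-> contracted e' pi (\det (tangent_mx p')).
Proof.
have [u uU ->] := jacobian_change; rewrite /contracted.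
suff -> : zero_locus e (\det (tangent_mx p)) =
          zero_locus e' (u * chi (\det (tangent_mx p))) by [].
apply/seteqP; split=> x; rewrite /zero_locus /= mevalM chi_eval.
  by move=> ->; rewrite mulr0.
move/eqP; rewrite mulf_eq0 => /orP[h|/eqP//].
have := rmorph_unit (meval (fun j => coord e' j x)) uU.
by rewrite unitfE -[_ u]/(u.@[_]) h.
Qed.

Variables a b : E.
Local Notation pb := (pullback (fun j => coord e j a) (fun j => coord e j b)).
Local Notation pb' := (pullback (fun j => coord e' j a) (fun j => coord e' j b)).
Local Notation pcst := (map_mx (@polyC K)).

Lemma pullbackC (c d : 'I_n.+1 -> K) k : pullback c d k%:MP = k%:P.
Proof. by rewrite [LHS]mmapC. Qed.

(** Both sides take at z the value of [g] at the point z a + b of E, which does not depend on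
    coordinates. *)
Lemma pullback_chi g : pb' (chi g) = pb g.
Proof.
apply/eqP; rewrite -subr_eq0; apply: contraT => /poly_neq0_nonroot[z].
rewrite hornerD hornerN !pullbackE; set l' := line_at _ _ _; set l := line_at _ _ _.
have e1 j : l' j = coord e' j (z *: a + b).
  by rewrite linearD linearZ /l' /line_at mulrC.
have e2 j : l j = coord e j (z *: a + b).
  by rewrite linearD linearZ /l /line_at mulrC.
by rewrite (meval_eq _ e1) (meval_eq _ e2) chi_eval subrr eqxx.
Qed.

Lemma pullback_tangent_change : map_mx pb' (tangent_mx p') =
  pcst A *m map_mx pb (tangent_mx p) *m pcst B.
Proof.
rewrite tangent_change !map_mxM; congr (_ *m _ *m _); apply/matrixP => i j.
- by rewrite !mxE /= pullbackC.
- by rewrite !mxE /= pullback_chi.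
- by rewrite !mxE /= pullbackC.
Qed.

Lemma pcst_mulmx (C D : 'M[K]_n.+1) : C *m D = 1%:M -> pcst C *m pcst D = 1%:M.
Proof. by move=> CD; rewrite -map_mxM CD map_mx1. Qed.

(** The constant base changes are absorbed by P and Q. The invariant factors are unchanged, so delta
    is the same polynomial and Q_N is the same vector in new coordinates. *)
Lemma smith_change (P Q : 'M[{poly K}]_n.+1) s :
  smith_form (map_mx pb (tangent_mx p)) P Q s ->
  smith_form (map_mx pb' (tangent_mx p')) (P *m pcst (change_mx v v'))
    (pcst (change_mx e' e) *m Q) s.
Proof.
move=> [uP uQ eD sd].
have vv := pcst_mulmx (change_mxK vb vb').
have ee := pcst_mulmx (change_mxK eb eb').
split=> //.
- by rewrite unitmx_mul uP /=; case: (mulmx1_unit vv).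
- by rewrite unitmx_mul uQ andbT; case: (mulmx1_unit ee).
rewrite pullback_tangent_change -eD !mulmxA.
rewrite -[P *m _ *m _]mulmxA vv mulmx1.
by rewrite -[X in X *m Q]mulmxA ee mulmx1.
Qed.

(** The differential of a function along a vector is intrinsic: the base change acting on the
    gradient cancels its inverse acting on Q. *)
Lemma tangent_along_change (G : {mpoly K[n.+1]}) (Q : 'M[{poly K}]_n.+1) u j0 :
  \sum_i pb' (u%:MP * chi G)^`M(i) * (pcst (change_mx e' e) *m Q) i j0 =
  u%:P * \sum_i pb G^`M(i) * Q i j0.
Proof.
have QE j : Q j j0 = \sum_i (B j i)%:P * (pcst (change_mx e' e) *m Q) i j0.
  have {1}-> : Q = pcst B *m (pcst (change_mx e' e) *m Q).
    by rewrite mulmxA (pcst_mulmx (change_mxK eb eb')) mul1mx.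
  by rewrite mxE; apply: eq_bigr => i _; rewrite mxE.
transitivity (\sum_j \sum_i u%:P * pb G^`M(j) * (B j i)%:P *
    (pcst (change_mx e' e) *m Q) i j0); last first.
  rewrite mulr_sumr; apply: eq_bigr => j _; rewrite QE; move: (pb _) => g.
  by rewrite mulrA mulr_sumr; apply: eq_bigr => i _; rewrite !mulrA.
rewrite exchange_big; apply: eq_bigr => i _; rewrite -mulr_suml; congr (_ * _).
rewrite mderiv_mulC rmorphM [pb' _%:MP]pullbackC linear_subst_deriv.
rewrite (rmorph_sum pb') mulr_sumr.
by apply: eq_bigr => j _; rewrite (rmorphM pb') pullback_chi [pb' _%:MP]pullbackC mulrA.
Qed.

Variables (t t' : nat) (f : 'I_t -> {mpoly K[n.+1]}) (f' : 'I_t' -> {mpoly K[n.+1]}).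
Variables (m : 'I_t -> nat) (m' : 'I_t' -> nat).
Hypothesis fact : factorization f m (\det (tangent_mx p)).
Hypothesis fact' : factorization f' m' (\det (tangent_mx p')).

Lemma radical_change : exists2 c : K, c != 0 &
  \prod_i f' i = c%:MP * chi (\prod_i f i).
Proof.
have [u uU eJ] := jacobian_change.
pose M : idomainType := {mpoly K[n.+1]}.
pose phi : {rmorphism M -> M} := chi.
pose psi : {rmorphism M -> M} := linear_subst (change_mx e' e).
have phiK : cancel phi psi by apply: linear_substK; exact: change_mxK.
have psiK : cancel psi phi by apply: linear_substK; exact: change_mxK.
have ip (x : M) : irreducible_elt x -> prime_elt x := @mpoly_irreducible_prime K n.+1 x.
have fact2 := factorization_iso ip phiK psiK uU fact.
rewrite -[phi _]/(chi _) -eJ in fact2.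
have [w wU ->] := factorization_rad ip fact2 fact'.
have /andP[/eqP ew w0] := wU.
exists w@_0%MM; first by rewrite -unitfE.
by rewrite -ew rmorph_prod.
Qed.

Lemma line_criterion_transfer (P Q : 'M[{poly K}]_n.+1) s :
  good_line p' f' (fun j => coord e' j a) (fun j => coord e' j b) ->
  smith_form (map_mx pb (tangent_mx p)) P Q s ->
  (contracted e pi (\det (tangent_mx p)) <->
   delta s %| \sum_i pb (\prod_(j < t) f j)^`M(i) * Q i ord_max).
Proof.
move=> gl /smith_change sm.
rewrite contracted_change (contractedP eb' vb' pE' fact') (line_criterion fact' gl sm).
have [c c0 ->] := radical_change.
by rewrite tangent_along_change mul_polyC dvdpZr.
Qed.

End Transfer.

(** * From nonvanishing polynomials to Zariski open sets of pairs *)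

Section PairsOpen.
Variables (K : numClosedFieldType) (n : nat) (E : vectType K) (e : n.+1.-tuple E).
Hypothesis eb : basis_of fullv e.
Local Notation cr x := (fun j : 'I_n.+1 => coord e j x).

Definition pairs_open (r : px_ring (pairs_ext K n.+1)) : set (E * E)%type :=
  [set ab | pair_eval (cr ab.1) (cr ab.2) r != 0].

Lemma pairs_open_zopen r : zopen (pairs_open r).
Proof.
pose l (i : 'I_(n.+1 + n.+1)) : {scalar (E * E)%type} :=
  match split i with inl j => coord e j \o fst | inr j => coord e j \o snd end.
pose h : {rmorphism {mpoly K[n.+1]} -> {mpoly K[n.+1 + n.+1]}} :=
  subst (fun j => 'X_(rshift n.+1 j)).
pose q := px_hom (pairs_ext K n.+1) h (fun j => 'X_(lshift n.+1 j)) r.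
have qE ab : pair_eval (cr ab.1) (cr ab.2) r = q.@[fun i => l i ab].
  apply: (pairs_rmorph_ext (phi := pair_eval (cr ab.1) (cr ab.2))
    (psi := meval (fun i => l i ab) \o
      px_hom (pairs_ext K n.+1) h (fun j => 'X_(lshift n.+1 j)))) => [c|j].
    rewrite [RHS]/= /pair_eval !px_homC.
    apply: (mpoly_rmorph_ext (phi := meval (cr ab.2))
      (psi := meval (fun i => l i ab) \o h)) => [d|j].
      by rewrite [LHS]mevalC /= /h [subst _ _]mmapC mevalC.
    by rewrite [LHS]mevalXU /= /h [subst _ _]mmapX mmap1U mevalXU /l (unsplitK (inr j)).
  by rewrite [RHS]/= /pair_eval !px_homU mevalXU /l (unsplitK (inl j)).
exists [set (fun ab => q.@[fun i => l i ab])]; split.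
  by move=> _ ->; exists (n.+1 + n.+1)%N, l, q.
apply/seteqP; split=> ab /=.
  by move=> /negP; rewrite negbK => /eqP h0 g ->; rewrite -qE.
by move=> /(_ _ erefl) h0; rewrite /pairs_open /= qE h0 eqxx.
Qed.

Lemma pairs_open_neq0 r : r != 0 -> pairs_open r !=set0.
Proof.
move=> /pair_eval_neq0[a [b h]].
have [x xa] := coord_surj eb a; have [y yb] := coord_surj eb b.
exists (x, y); rewrite /pairs_open /=.
have -> : cr x = a by apply/funext.
by have -> : cr y = b by apply/funext.
Qed.

(** The extra factor is the first coordinate of a, whose nonvanishing forces a to be nonzero. *)
Lemma pairs_open_Aff1 r :
  pairs_open (r * px_var (pairs_ext K n.+1) ord0) `<=` Aff1 (E := E).
Proof.
move=> [a b]; rewrite /pairs_open /Aff1 /= rmorphM mulf_eq0 negb_or => /andP[_].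
by apply: contra => /eqP ->; rewrite /pair_eval px_homU linear0.
Qed.

End PairsOpen.

Lemma basis_tuple_exists (K : fieldType) (W : vectType K) d :
  \dim {:W} = d -> exists e : d.-tuple W, basis_of fullv e.
Proof. by move=> <-; exists (vbasis fullv); exact: vbasisP. Qed.

Lemma line_criterion_generic (K : numClosedFieldType) (n : nat) (E V : vectType K)
    (dimE : \dim {:E} = n.+1) (pi : E -> V) :
  exists U : set (E * E)%type,
    [/\ zopen U, U !=set0, U `<=` Aff1 (E := E) &
      forall (e : n.+1.-tuple E) (v : n.+1.-tuple V)
        (p : 'I_n.+1 -> {mpoly K[n.+1]}),
        basis_of fullv e -> basis_of fullv v -> components e v pi p ->
      forall (t : nat) (f : 'I_t -> {mpoly K[n.+1]}) (m : 'I_t -> nat),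
        factorization f m (\det (tangent_mx p)) ->
      forall (a b : E), U (a, b) ->
      forall (P Q : 'M[{poly K}]_n.+1) (s : 'rV[{poly K}]_n.+1),
        smith_form (map_mx (line_pullback e a b) (tangent_mx p)) P Q s ->
      (contracted e pi (\det (tangent_mx p)) <->
       delta s %| tangent_along e a b (\prod_(i < t) f i) (col ord_max Q))].
Proof.
have x0 : px_var (pairs_ext K n.+1) ord0 != 0.
  apply/eqP => h.
  have := @px_homU _ _ _ (pairs_ext K n.+1) _ (meval (fun=> 0)) (fun=> 1 : K) ord0.
  by rewrite h rmorph0 => /eqP; rewrite eq_sym oner_eq0.
pose data (e : n.+1.-tuple E) (v : n.+1.-tuple V) p t f m :=
  [/\ basis_of fullv e, basis_of fullv v, components e v pi p &
      @factorization _ t f m (\det (tangent_mx p))].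
have [[e' [v' [p' [t' [f' [m' [eb' vb' pE' fact']]]]]]]|nodata] :=
  pselect (exists e v p t f m, @data e v p t f m); last first.
  (* Without admissible data the equivalence is vacuous, but a nonempty open subset of [Aff1] is
     still required: r = 1 is used, in any basis of E. *)
  have [e eb] := basis_tuple_exists dimE.
  exists (pairs_open e (1 * px_var (pairs_ext K n.+1) ord0)); split.
  - exact: pairs_open_zopen.
  - by apply: pairs_open_neq0; rewrite ?mul1r.
  - exact: pairs_open_Aff1.
  move=> e1 v1 p eb1 vb1 pE t f m fact; exfalso.
  by apply: nodata; exists e1, v1, p, t, f, m.
have [r [r0 rP]] := generic_good_line fact'.
exists (pairs_open e' (r * px_var (pairs_ext K n.+1) ord0)); split.
- exact: pairs_open_zopen.
- by apply: pairs_open_neq0 => //; rewrite mulf_neq0.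
- exact: pairs_open_Aff1.
move=> e v p eb vb pE t f m fact a b Uab P Q s sm.
have gl : good_line p' f' (fun j => coord e' j a) (fun j => coord e' j b).
  apply: rP; move: Uab; rewrite /pairs_open /= rmorphM mulf_eq0 negb_or.
  by case/andP.
have := line_criterion_transfer eb eb' vb vb' pE pE' fact fact' gl sm.
have -> // : \sum_i pullback (fun j => coord e j a) (fun j => coord e j b)
    (\prod_(j < t) f j)^`M(i) * Q i ord_max =
  tangent_along e a b (\prod_(i < t) f i) (col ord_max Q).
by apply: eq_bigr => i _; rewrite mxE.
Qed.

Theorem theorem10 (R : realType) (n : nat) (E V : vectType R[i])
    (dimE : \dim {:E} = n.+1) (dimV : \dim {:V} = n.+1)
    (pi : E -> V) (pi_morph : morphism pi) (pi_dom : dominant pi) :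
  exists U : set (E * E)%type,
    [/\ zopen U, U !=set0, U `<=` Aff1 (E := E) &
      forall (e : n.+1.-tuple E) (v : n.+1.-tuple V)
        (p : 'I_n.+1 -> {mpoly R[i][n.+1]}),
        basis_of fullv e -> basis_of fullv v -> components e v pi p ->
      forall (t : nat) (f : 'I_t -> {mpoly R[i][n.+1]}) (m : 'I_t -> nat),
        factorization f m (\det (tangent_mx p)) ->
      forall (a b : E), U (a, b) ->
      forall (P Q : 'M[{poly R[i]}]_n.+1) (s : 'rV[{poly R[i]}]_n.+1),
        smith_form (map_mx (line_pullback e a b) (tangent_mx p)) P Q s ->
      (contracted e pi (\det (tangent_mx p)) <->
       delta s %| tangent_along e a b (\prod_(i < t) f i) (col ord_max Q))].
Proof. exact: (@line_criterion_generic R[i] n E V dimE pi). Qed.
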